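(* Let $X$ be a $C^*$-correspondence over a $C^*$-algebra $A$. Let $\mathcal J$ be an ideal in the $C^*$-precategory $\mathcal T_X$ and put $J:=\mathcal J(0,0)$, an ideal in $A$. Then $$\mathcal K_X(J)\subset\mathcal J\subset\mathcal T_X(J).$$ In particular, the relations $J=\mathcal J(0,0)$, $\mathcal J=\mathcal K_X(J)$ establish a one-to-one correspondence between ideals $J$ in $A$ and ideals $\mathcal J$ in $\mathcal K_X$.
   Context: Ideals in $C^*$-algebras are closed and two-sided. A $C^*$-correspondence $X$ over $A$ is a right Hilbert $A$-module with a $*$-homomorphism $\phi:A\to\mathcal L(X)$ into the adjointable operators. $X^{\otimes 0}:=A$ and $X^{\otimes n}$ is the $n$-fold (interior) tensor product. For Hilbert $A$-modules $Y,Z$: $\mathcal L(Y,Z)$ denotes adjointable maps, $\mathcal K(Y,Z)=\overline{\mathrm{span}}\{\Theta_{z,y}\}$ with $\Theta_{z,y}(w)=z\langle y,w\rangle_A$ the ''compact'' ones. For an ideal $J$ in $A$, $ZJ=\{zj: z\in Z,\ j\in J\}$ is a Hilbert submodule, $\mathcal K(Y,ZJ)$ is regarded as the subspace $\overline{\mathrm{span}}\{\Theta_{z,y}:y\in Y,z\in ZJ\}$ of $\mathcal K(Y,Z)$, and $\mathcal L_J(Y,Z)=\{a\in\mathcal L(Y,Z): a(Y)\subset ZJ\}$ (equivalently $a^*(Z)\subset YJ$). $\mathcal T_X$ is the family of spaces $\mathcal T_X(n,m)$, $n,m\in\mathbb N=\{0,1,2,\dots\}$, with $\mathcal T_X(n,m)=\mathcal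 K(X^{\otimes m},X^{\otimes n})$ if $n=0$ or $m=0$, and $\mathcal T_X(n,m)=\mathcal L(X^{\otimes m},X^{\otimes n})$ if $n,m\ge1$, with composition, adjoint and operator norm. In particular $\mathcal T_X(0,0)=\mathcal K(A)=A$ and $\mathcal T_X(n,0)=\mathcal K(A,X^{\otimes n})=X^{\otimes n}$. An ideal in such a family $\mathcal T$ is a family of closed subspaces $\mathcal J(n,m)\subset\mathcal T(n,m)$ with $\mathcal T(n,m)\mathcal J(m,l)\subset\mathcal J(n,l)$ and $\mathcal J(n,m)\mathcal T(m,l)\subset\mathcal J(n,l)$ for all $n,m,l\in\mathbb N$. Inclusions of families are entrywise. Put $\mathcal K_X:=\{\mathcal K(X^{\otimes m},X^{\otimes n})\}_{n,m}$, $\mathcal K_X(J):=\{\mathcal K(X^{\otimes m},X^{\otimes n}J)\}_{n,m}$, and $\mathcal T_X(J)(n,m):=\mathcal L_J(X^{\otimes m},X^{\otimes n})\cap\mathcal T_X(n,m)$. An ideal in $\mathcal K_X$ is a family of closed subspaces $\mathcal J(n,m)\subset\mathcal K_X(n,m)=\mathcal K(X^{\otimes m},X^{\otimes n})$ with $\mathcal K_X(n,m)\mathcal J(m,l)\subset\mathcal J(n,l)$ and $\mathcal J(n,m)\mathcal K_X(m,l)\subset\mathcal J(n,l)$ for all $n,m,l\in\mathbb N$. *)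

(* Defs.v *)
From HB Require Import structures.
From mathcomp Require Import all_boot all_order all_algebra.
From mathcomp Require Import all_classical all_reals all_analysis.
From mathcomp Require Export complex.

Set Implicit Arguments.
Unset Strict Implicit.
Unset Printing Implicit Defensive.

Import Order.TTheory GRing.Theory Num.Theory.
Import numFieldNormedType.Exports.
Local Open Scope classical_set_scope.
Local Open Scope ring_scope.
Local Open Scope complex_scope.

(* Algebras need not be unital, hence the product is not the ring product of
   the algebraic hierarchy. The norm of a complex Banach space takes its values
   in R[i]. *)
HB.mixin Record CompleteNormedModule_isCstar (R : realType) (A : Type)
    of CompleteNormedModule R[i] A := {
  cmul : A -> A -> A ;
  cstar : A -> A ;
  cmulA : forall a b c : A, cmul a (cmul b c) = cmul (cmul a b) c ;
  cmul_linearl : forall (k : R[i]) (a b c : A),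
    cmul (k *: a + b) c = k *: cmul a c + cmul b c ;
  cmul_linearr : forall (k : R[i]) (a b c : A),
    cmul c (k *: a + b) = k *: cmul c a + cmul c b ;
  cstarK : forall a : A, cstar (cstar a) = a ;
  cstarM : forall a b : A, cstar (cmul a b) = cmul (cstar b) (cstar a) ;
  cstar_antilinear : forall (k : R[i]) (a b : A),
    cstar (k *: a + b) = k^*%C *: cstar a + cstar b ;
  cnormM : forall a b : A, `|cmul a b| <= `|a| * `|b| ;
  cnorm_star : forall a : A, `|cmul (cstar a) a| = `|a| ^+ 2
}.

#[short(type="cstarType")]
HB.structure Definition Cstar (R : realType) :=
  {A of CompleteNormedModule R[i] A & CompleteNormedModule_isCstar R A}.

Definition cpositive (R : realType) (A : cstarType R) (a : A) : Prop :=
  exists b : A, a = cmul (cstar b) b.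

(* Inner products are linear in the second variable. *)
HB.mixin Record CompleteNormedModule_isHilbertModule (R : realType)
    (A : cstarType R) (E : Type) of CompleteNormedModule R[i] E := {
  ract : E -> A -> E ;
  inner : E -> E -> A ;
  ract_linearl : forall (k : R[i]) (x y : E) (a : A),
    ract (k *: x + y) a = k *: ract x a + ract y a ;
  ract_linearr : forall (k : R[i]) (x : E) (a b : A),
    ract x (k *: a + b) = k *: ract x a + ract x b ;
  ractA : forall (x : E) (a b : A), ract x (cmul a b) = ract (ract x a) b ;
  inner_linearr : forall (k : R[i]) (x y z : E),
    inner x (k *: y + z) = k *: inner x y + inner x z ;
  inner_ract : forall (x y : E) (a : A),
    inner x (ract y a) = cmul (inner x y) a ;
  inner_star : forall x y : E, cstar (inner x y) = inner y x ;
  inner_ge0 : forall x : E, cpositive (inner x x) ;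
  norm_inner : forall x : E, `|x| ^+ 2 = `|inner x x|
}.

#[short(type="hilbertModType")]
HB.structure Definition HilbertModule (R : realType) (A : cstarType R) :=
  {E of CompleteNormedModule R[i] E
      & CompleteNormedModule_isHilbertModule R A E}.

Section SelfModule.
Context (R : realType) (A : cstarType R).

Let self_inner_linearr (k : R[i]) (x y z : A) :
  cmul (cstar x) (k *: y + z) = k *: cmul (cstar x) y + cmul (cstar x) z.
Proof. exact: cmul_linearr. Qed.

Let self_inner_ract (x y a : A) :
  cmul (cstar x) (cmul y a) = cmul (cmul (cstar x) y) a.
Proof. exact: cmulA. Qed.

Let self_inner_star (x y : A) :
  cstar (cmul (cstar x) y) = cmul (cstar y) x.
Proof. by rewrite cstarM cstarK. Qed.

Let self_inner_ge0 (x : A) : cpositive (cmul (cstar x) x).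
Proof. by exists x. Qed.

Let self_norm_inner (x : A) : `|x| ^+ 2 = `|cmul (cstar x) x|.
Proof. by rewrite cnorm_star. Qed.

(* A as a Hilbert module over itself, with <a, b> = a^* b *)
Definition self_module : hilbertModType A :=
  HB.pack (Cstar.sort A)
    (CompleteNormedModule_isHilbertModule.Build R A A
      (fun k x y a => cmul_linearl k x y a)
      (fun k x a b => cmul_linearr k a b x)
      (@cmulA R A) self_inner_linearr self_inner_ract self_inner_star
      self_inner_ge0 self_norm_inner).

End SelfModule.

Section Subspaces.
Context (R : realType) (V : lmodType R[i]).

Definition subspace (S : set V) : Prop :=
  S 0 /\ forall (k : R[i]) (x y : V), S x -> S y -> S (k *: x + y).

Definition linspan (S : set V) : set V :=
  [set x | exists n (k : 'I_n -> R[i]) (s : 'I_n -> V),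
     (forall i, S (s i)) /\ x = \sum_(i < n) k i *: s i].

End Subspaces.

Definition cstar_ideal (R : realType) (A : cstarType R) (J : set A) : Prop :=
  [/\ subspace J, closed J,
      forall a b : A, J b -> J (cmul a b) &
      forall a b : A, J a -> J (cmul a b)].

Section Operators.
Context (R : realType) (A : cstarType R).
Implicit Types Y Z : hilbertModType A.

Definition is_adjoint Y Z (T : Y -> Z) (S : Z -> Y) : Prop :=
  forall (y : Y) (z : Z), inner (T y) z = inner y (S z).

(* \mathcal L(Y, Z); such maps are automatically linear and bounded. *)
Definition adjointable Y Z : set (Y -> Z) :=
  [set T | exists S : Z -> Y, is_adjoint T S].

Definition opnorm Y Z (T : Y -> Z) : \bar R :=
  ereal_sup [set (complex.Re `|T y|)%:E | y in [set y : Y | `|y| <= 1]].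

Definition opclosure Y Z (S : set (Y -> Z)) : set (Y -> Z) :=
  [set T | adjointable T /\
     forall e : R, 0 < e -> exists2 T', S T' & (opnorm (T - T')%R < e%:E)%E].

Definition opclosed Y Z (S : set (Y -> Z)) : Prop := opclosure S `<=` S.

Definition theta Y Z (z : Z) (y : Y) : Y -> Z := fun w => ract z (inner y w).

(* the closed span of the theta z y with z in P *)
Definition compacts_in Y Z (P : set Z) : set (Y -> Z) :=
  opclosure (linspan [set theta z y | z in P & y in [set: Y]]).

Definition compacts Y Z : set (Y -> Z) := compacts_in [set: Z].

Definition mod_ideal Z (J : set A) : set Z :=
  [set ract z j | z in [set: Z] & j in J].

Definition adjointable_in Y Z (J : set A) : set (Y -> Z) :=
  [set T | adjointable T /\ range T `<=` mod_ideal J].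

End Operators.

HB.mixin Record HilbertModule_isCorrespondence (R : realType)
    (A : cstarType R) (X : Type) of HilbertModule R A X := {
  lact : A -> X -> X ;
  lact_linear : forall (k : R[i]) (a b : A) (x : X),
    lact (k *: a + b) x = k *: lact a x + lact b x ;
  lactM : forall (a b : A) (x : X), lact (cmul a b) x = lact a (lact b x) ;
  lact_adjoint : forall a : A, is_adjoint (lact a) (lact (cstar a))
}.

#[short(type="cstarCorrType")]
HB.structure Definition Correspondence (R : realType) (A : cstarType R) :=
  {X of HilbertModule R A X & HilbertModule_isCorrespondence R A X}.

Section TensorPowers.
Context (R : realType) (A : cstarType R).

(* Z, with elementary tensors tau y x, is an interior tensor product of Y and
   X: the algebraic tensor product balanced over A maps onto a dense subspace
   of the (complete) module Z, and the inner product of Z is the one that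
   defines the interior tensor product. This determines Z up to a unique
   unitary compatible with the elementary tensors. *)
Record interior_tensor (Y : hilbertModType A) (X : cstarCorrType A)
    (Z : hilbertModType A) (tau : Y -> X -> Z) : Prop := InteriorTensor {
  tensor_linearl : forall (k : R[i]) (y y' : Y) (x : X),
    tau (k *: y + y') x = k *: tau y x + tau y' x ;
  tensor_linearr : forall (k : R[i]) (y : Y) (x x' : X),
    tau y (k *: x + x') = k *: tau y x + tau y x' ;
  tensor_balanced : forall (y : Y) (a : A) (x : X),
    tau (ract y a) x = tau y (lact a x) ;
  tensor_ract : forall (y : Y) (x : X) (a : A),
    ract (tau y x) a = tau y (ract x a) ;
  tensor_inner : forall (y y' : Y) (x x' : X),
    inner (tau y x) (tau y' x') = inner x (lact (inner y y') x') ;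
  tensor_dense :
    closure (linspan [set tau y x | y in [set: Y] & x in [set: X]]) = setT
}.

(* The powers 0 and 1 are A and X on the nose; in particular the power 1 is
   not A tensor X, which is smaller than X when the left action is
   degenerate. P n is the power n + 2. *)
Definition tpow_of (X : cstarCorrType A) (P : nat -> hilbertModType A)
    (n : nat) : hilbertModType A :=
  match n with
  | 0 => self_module A
  | 1 => X
  | m.+2 => P m
  end.

(* A choice of the interior tensor powers of X, each of them being determined
   up to unitary equivalence. *)
Record tensorPowers (X : cstarCorrType A) := TensorPowers {
  tpow_ge2 : nat -> hilbertModType A ;
  tpow_tensor : forall n,
    tpow_of X tpow_ge2 n.+1 -> X -> tpow_of X tpow_ge2 n.+2 ;
  tpow_tensorP : forall n, interior_tensor (@tpow_tensor n)
}.

Definition tpow (X : cstarCorrType A) (P : tensorPowers X) :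
  nat -> hilbertModType A := tpow_of X (tpow_ge2 P).

End TensorPowers.

Section Families.
Context (R : realType) (A : cstarType R) (X : cstarCorrType A).
Context (P : tensorPowers X).

Definition op_family : Type := forall n m : nat, set (tpow P m -> tpow P n).

Definition subfamily (F G : op_family) : Prop :=
  forall n m, F n m `<=` G n m.

Definition is_ideal_of (T J : op_family) : Prop :=
  [/\ subfamily J T,
      forall n m, subspace (J n m) /\ opclosed (J n m),
      forall n m l a b, T n m a -> J m l b -> J n l (a \o b) &
      forall n m l a b, J n m a -> T m l b -> J n l (a \o b)].

Definition KX : op_family := fun n m => compacts (Z := tpow P n).

Definition TX : op_family := fun n m =>
  if (n == 0%N) || (m == 0%N) then compacts (Z := tpow P n)
  else adjointable (Z := tpow P n).

Definition KXJ (J : set A) : op_family := fun n m =>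
  compacts_in (mod_ideal (Z := tpow P n) J).

Definition TXJ (J : set A) : op_family := fun n m =>
  adjointable_in (Z := tpow P n) J `&` TX (n:=n) (m:=m).

(* F(0, 0) as a subset of A, where a in A is identified with the left
   multiplication by a, an element of K(A). *)
Definition corner00 (F : op_family) : set A :=
  [set a | F 0%N 0%N (fun b : A => cmul a b)].

End Families.

Arguments op_family {R A X} P.
Arguments KX {R A X} P n m _.
Arguments TX {R A X} P n m _.
Arguments KXJ {R A X} P J n m _.
Arguments TXJ {R A X} P J n m _.

(* Main.v *)
(* Every vector x of a Hilbert A-module whose inner products <y, x> all lie in a
   closed ideal I factors as x = z j with j in I (Cohen). With I = A this shows
   that b |-> x b and <y, -> are rank one operators between A and X^n, so each
   of them lies in T_X or K_X; composing elements of an ideal with them on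
   either side gives both inclusions. For an ideal J of K_X and a in J, the
   operator k a with k of finite rank and |a - k a| small is a sum of operators
   theta u (a^* v) with a^* v in X^m J(0,0), hence a is in K_X(J(0,0)).

   The approximate units come from resolvents: for h = <x, x>, put
   s = t h^2 (1 + t h^2)^-1 with t large. That 1 - s is a contraction only uses
   that h is selfadjoint, so no spectral theory nor positivity of sums of
   positive elements is needed. *)
From mathcomp Require Import all_boot all_order all_algebra.
From mathcomp Require Import all_classical all_reals all_analysis.
From mathcomp Require Import ring lra.
From HB Require Import structures.
Require Import Defs.

Set Implicit Arguments.
Unset Strict Implicit.
Unset Printing Implicit Defensive.

Import Order.TTheory GRing.Theory Num.Theory.
Import numFieldNormedType.Exports.
Local Open Scope classical_set_scope.
Local Open Scope ring_scope.
Local Open Scope complex_scope.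

(** * Norms as real numbers *)

Section RealNorm.
Context (R : realType) (V : normedModType R[i]).
Implicit Types (x y : V) (r : R) (k : R[i]).

(** The norm takes values in [R[i]]; its real part lives in the ordered field [R], where real
    inequalities and limits apply. *)
Definition nrm x : R := complex.Re `|x|.

Lemma nrmE x : (nrm x)%:C = `|x|.
Proof. by rewrite /nrm RRe_real; last exact: normr_real. Qed.

Lemma nrm_ge0 x : 0 <= nrm x.
Proof. by rewrite -lecR nrmE; exact: normr_ge0. Qed.

Lemma nrm0 : nrm 0 = 0.
Proof. by apply: (@complexI R); rewrite nrmE normr0. Qed.

Lemma nrm_eq0 x : (nrm x == 0) = (x == 0).
Proof.
apply/eqP/eqP => [x0|->]; last exact: nrm0.
by apply: normr0_eq0; rewrite -nrmE x0.
Qed.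

Lemma nrmN x : nrm (- x) = nrm x.
Proof. by rewrite /nrm normrN. Qed.

Lemma nrmBC x y : nrm (x - y) = nrm (y - x).
Proof. by rewrite -nrmN opprB. Qed.

Lemma nrmD x y : nrm (x + y) <= nrm x + nrm y.
Proof. by rewrite -lecR rmorphD /= !nrmE ler_normD. Qed.

Lemma nrmB x y : nrm (x - y) <= nrm x + nrm y.
Proof. by rewrite -(nrmN y) nrmD. Qed.

Lemma nrmZ k x : nrm (k *: x) = complex.Re `|k| * nrm x.
Proof.
apply: (@complexI R); rewrite nrmE normrZ -nrmE.
by rewrite -{1}(RRe_real (normr_real k)) -rmorphM.
Qed.

Lemma nrmZr r x : nrm (r%:C *: x) = `|r| * nrm x.
Proof. by rewrite nrmZ normc_def /= expr0n addr0 sqrtr_sqr. Qed.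

Lemma nrm_sum (I : Type) (s : seq I) (F : I -> V) :
  nrm (\sum_(i <- s) F i) <= \sum_(i <- s) nrm (F i).
Proof.
elim/big_ind2: _ => [|x r y t xr yt|//]; first by rewrite nrm0.
by rewrite (le_trans (nrmD _ _)) ?lerD.
Qed.

Lemma nrm_le0 x : (forall e, 0 < e -> nrm x <= e) -> x = 0.
Proof.
move=> xe; apply/eqP; rewrite -nrm_eq0 eq_le nrm_ge0 andbT.
by apply/ler_addgt0Pl => e e0; rewrite addr0 xe.
Qed.

Lemma nbhs_nrmP (x : V) (B : set V) :
  nbhs x B <-> exists2 e : R, 0 < e & forall y, nrm (x - y) < e -> B y.
Proof.
split.
  move/nbhs_ballP => [e /= e0 eB]; have er := gtr0_real e0.
  exists (complex.Re e); first by rewrite -ltcR RRe_real.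
  move=> y xy; apply: eB; rewrite -ball_normE /=.
  by rewrite -nrmE -(RRe_real er) ltcR.
move=> [e e0 eB]; apply/nbhs_ballP; exists e%:C; first by rewrite /= ltcR.
by move=> y; rewrite -ball_normE /= -nrmE ltcR => /eB.
Qed.

Lemma closure_nrm (J : set V) x :
  closure J x <-> forall e : R, 0 < e -> exists2 y, J y & nrm (x - y) < e.
Proof.
split=> [Jx e e0|Jx B /nbhs_nrmP[e e0 eB]].
  have /Jx [y [Jy xy]] : nbhs x [set y | nrm (x - y) < e].
    by apply/nbhs_nrmP; exists e.
  by exists y.
by have [y Jy /eB By] := Jx _ e0; exists y.
Qed.

Lemma closed_nrm (J : set V) : closed J ->
  forall x, (forall e : R, 0 < e -> exists2 y, J y & nrm (x - y) < e) -> J x.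
Proof. by move=> cJ x Jx; apply/cJ/closure_nrm. Qed.

End RealNorm.

Lemma nrm_sqr (R : realType) (V W : normedModType R[i]) (x : V) (y : W) :
  `|x| ^+ 2 = `|y| -> nrm x ^+ 2 = nrm y.
Proof. by rewrite -!nrmE => xy; apply: (@complexI R); rewrite rmorphXn /= xy. Qed.

Lemma geometric_lt (R : realType) (c q e : R) : 0 <= c -> 0 <= q < 1 -> 0 < e ->
  exists n, c * q ^+ n < e.
Proof.
move=> c0 /andP[q0 q1] e0; have : (fun n => c * q ^+ n) @ \oo --> (0 : R).
  by rewrite -[X in _ --> X](mulr0 c); apply: cvgMr; apply: cvg_expr;
     rewrite ger0_norm.
move/cvgrPdist_lt => /(_ _ e0)[N _ /(_ N (leqnn _))] /=.
by rewrite sub0r normrN ger0_norm ?mulr_ge0 ?exprn_ge0//; exists N.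
Qed.

(** * Geometric and Neumann series in Banach spaces *)

Section Completeness.
Context (R : realType) (V : completeNormedModType R[i]).

Lemma geometric_cvg (u : nat -> V) (c q : R) : 0 <= c -> 0 <= q < 1 ->
  (forall n, nrm (u n.+1 - u n) <= c * q ^+ n) ->
  exists l, forall n, nrm (l - u n) <= c * q ^+ n / (1 - q).
Proof.
move=> c0 q01 uc; have /andP[q0 q1] := q01.
have q1' : 0 < 1 - q by rewrite subr_gt0.
have ub m n : nrm (u (m + n)%N - u m) <= c * q ^+ m / (1 - q).
  (* The induction runs on the exact partial geometric sum. *)
  suff: nrm (u (m + n)%N - u m) <= c * (q ^+ m - q ^+ (m + n)) / (1 - q).
    move/le_trans; apply; rewrite ler_pM2r ?invr_gt0// ler_wpM2l// lerBlDr.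
    by rewrite lerDl exprn_ge0.
  elim: n => [|n IH]; first by rewrite addn0 !subrr nrm0 mulr0 mul0r.
  rewrite addnS -(subrKA (u (m + n)%N)) (le_trans (nrmD _ _))//.
  rewrite (le_trans (lerD (uc _) IH))// exprS le_eqVlt; apply/orP; left.
  by apply/eqP; field; rewrite gt_eqF.
have small e : 0 < e -> exists n, c * q ^+ n / (1 - q) < e.
  move=> e0; have [|n ne] := @geometric_lt _ (c / (1 - q)) q e _ q01 e0.
    by rewrite divr_ge0// ltW.
  by exists n; rewrite mulrAC.
have cu : cauchy (u @ \oo).
  apply/cauchy_exP => e e0; have er := gtr0_real e0.
  have [|n ne] := small (complex.Re e); first by rewrite -ltcR RRe_real.
  exists (u n); exists n => // k /= nk; rewrite -ball_normE /=.
  rewrite -nrmE -(RRe_real er) ltcR nrmBC -(subnKC nk).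
  exact: le_lt_trans (ub _ _) ne.
have /cauchy_cvg/cvg_ex[l ul] := cu.
exists l => n; apply/ler_addgt0Pl => e e0.
have : nbhs l [set y | nrm (l - y) < e] by apply/nbhs_nrmP; exists e.
move=> /ul [N _ /(_ (n + N)%N (leq_addl _ _))] /= lN.
rewrite -(subrKA (u (n + N)%N)) (le_trans (nrmD _ _))// lerD// ltW//.
Qed.

(** The iterates of x |-> y + f x from 0 have increments that shrink by the factor q, and their
    limit is a fixed point. *)
Lemma neumann (f : V -> V) (q : R) : 0 <= q < 1 ->
  {morph f : x y / x - y} -> (forall x, nrm (f x) <= q * nrm x) ->
  forall y, exists x, x = y + f x.
Proof.
move=> q01 fB fq y; have /andP[q0 q1] := q01.
pose u := fix u n := if n is m.+1 then y + f (u m) else 0.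
have us n : u n.+1 = y + f (u n) by [].
have [n|l lu] := geometric_cvg (u := u) (nrm_ge0 (u 1%N)) q01.
  elim: n => [|n IH]; first by rewrite expr0 mulr1 subr0.
  rewrite (us n.+1) (us n) opprD addrACA subrr add0r -fB.
  by rewrite (le_trans (fq _))// exprSr mulrA mulrC ler_wpM2r.
set c := nrm (u 1%N) in lu; exists l; apply/eqP; rewrite -subr_eq0; apply/eqP.
apply: nrm_le0 => e e0; have q1' : 0 < 1 - q by rewrite subr_gt0.
have c0 : 0 <= c / (1 - q) by rewrite divr_ge0 ?nrm_ge0// ltW.
(* The defect l - (y + f l) is split at the iterate N + 1; each half is at most c q^N / (1 - q),
   whence the factor 2. *)
have [N /ltW] := geometric_lt (mulr_ge0 (ler0n R 2) c0) q01 e0.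
rewrite -mulrA mulrAC; apply: le_trans.
have b0 : 0 <= c * q ^+ N / (1 - q) by rewrite mulrAC mulr_ge0 ?exprn_ge0.
rewrite -(subrKA (u N.+1)) us (le_trans (nrmD _ _))// mulr2n mulrDl mul1r lerD//.
  rewrite -us (le_trans (lu _))// ler_pM2r ?invr_gt0// ler_wpM2l ?nrm_ge0// exprS.
  by rewrite ler_piMl ?exprn_ge0// ltW.
rewrite opprD addrACA subrr add0r -fB (le_trans (fq _))//.
rewrite (le_trans (ler_wpM2l q0 _) (ler_piMl b0 (ltW q1)))// nrmBC.
exact: lu.
Qed.

End Completeness.

(** * Arithmetic and norm identities in C*-algebras *)

Section CstarAlgebra.
Context (R : realType) (A : cstarType R).
Implicit Types (a b c : A) (k : R[i]).

HB.instance Definition _ a :=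
  GRing.isLinear.Build R[i] A A *:%R (cmul a)
    (fun k b c => cmul_linearr k b c a).

Lemma cmulDl a b c : cmul (a + b) c = cmul a c + cmul b c.
Proof. by rewrite -[a]scale1r cmul_linearl !scale1r. Qed.

Lemma cmul0l c : cmul 0 c = 0.
Proof. by apply: (addrI (cmul 0 c)); rewrite -cmulDl !addr0. Qed.

Lemma cmulZl k a c : cmul (k *: a) c = k *: cmul a c.
Proof. by rewrite -[k *: a]addr0 cmul_linearl cmul0l addr0. Qed.

Lemma cmulNl a c : cmul (- a) c = - cmul a c.
Proof. by rewrite -scaleN1r cmulZl scaleN1r. Qed.

Lemma cmulBl a b c : cmul (a - b) c = cmul a c - cmul b c.
Proof. by rewrite cmulDl cmulNl. Qed.

Lemma cmulDr a b c : cmul a (b + c) = cmul a b + cmul a c.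
Proof. exact: linearD. Qed.

Lemma cmulBr a b c : cmul a (b - c) = cmul a b - cmul a c.
Proof. exact: linearB. Qed.

Lemma cmulZr k a b : cmul a (k *: b) = k *: cmul a b.
Proof. exact: linearZ. Qed.

Lemma cstarD a b : cstar (a + b) = cstar a + cstar b.
Proof. by rewrite -[a]scale1r cstar_antilinear conjc1 !scale1r. Qed.

Lemma cstar0 : cstar 0 = 0 :> A.
Proof. by apply: (addrI (cstar 0)); rewrite -cstarD !addr0. Qed.

Lemma cstarZ k a : cstar (k *: a) = k^*%C *: cstar a.
Proof. by rewrite -[k *: a]addr0 cstar_antilinear cstar0 addr0. Qed.

Lemma nrmM a b : nrm (cmul a b) <= nrm a * nrm b.
Proof. by rewrite -lecR rmorphM /= !nrmE cnormM. Qed.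

Lemma nrm_starM a : nrm (cmul (cstar a) a) = nrm a ^+ 2.
Proof. exact/esym/nrm_sqr/esym/cnorm_star. Qed.

(** Cancelling |b| in |b|^2 = |b^* b| <= |b^*| |b| gives one inequality; applying it to b = a and b
    = a^* gives both. *)
Lemma nrm_star a : nrm (cstar a) = nrm a.
Proof.
have le b : nrm b <= nrm (cstar b).
  have [->|] := eqVneq b 0; first by rewrite nrm0 nrm_ge0.
  rewrite -nrm_eq0 => b0; have : 0 < nrm b by rewrite lt_def b0 nrm_ge0.
  by move=> /ler_pM2r <-; rewrite -expr2 -nrm_starM nrmM.
by apply/eqP; rewrite eq_le le andbT -{2}(cstarK a) le.
Qed.

Lemma nrm_Mstar a : nrm (cmul a (cstar a)) = nrm a ^+ 2.
Proof. by rewrite -{1}(cstarK a) nrm_starM nrm_star. Qed.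

End CstarAlgebra.

(** * Hilbert modules: sesquilinearity and norm estimates *)

Section HilbertModules.
Context (R : realType) (A : cstarType R) (E : hilbertModType A).
Implicit Types (x y z w : E) (a b : A) (k : R[i]).

HB.instance Definition _ x :=
  GRing.isLinear.Build R[i] A E *:%R (ract x)
    (fun k a b => ract_linearr k x a b).

HB.instance Definition _ x :=
  GRing.isLinear.Build R[i] E A *:%R (inner x)
    (fun k y z => inner_linearr k x y z).

Lemma ractDl x y a : ract (x + y) a = ract x a + ract y a.
Proof. by rewrite -[x]scale1r ract_linearl !scale1r. Qed.

Lemma ractDr x a b : ract x (a + b) = ract x a + ract x b.
Proof. exact: linearD. Qed.

Lemma ractBr x a b : ract x (a - b) = ract x a - ract x b.
Proof. exact: linearB. Qed.

Lemma ractZr k x a : ract x (k *: a) = k *: ract x a.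
Proof. exact: linearZ. Qed.

Lemma ract0l a : ract (0 : E) a = 0.
Proof. by apply: (addrI (ract 0 a)); rewrite -ractDl !addr0. Qed.

Lemma ractZl k x a : ract (k *: x) a = k *: ract x a.
Proof. by rewrite -[k *: x]addr0 ract_linearl ract0l addr0. Qed.

Lemma ractNl x a : ract (- x) a = - ract x a.
Proof. by rewrite -scaleN1r ractZl scaleN1r. Qed.

Lemma ractBl x y a : ract (x - y) a = ract x a - ract y a.
Proof. by rewrite ractDl ractNl. Qed.

Lemma innerDl x y z : inner (x + y) z = inner x z + inner y z.
Proof. by rewrite -inner_star linearD cstarD !inner_star. Qed.

Lemma innerDr x y z : inner x (y + z) = inner x y + inner x z.
Proof. exact: linearD. Qed.

Lemma innerBr x y z : inner x (y - z) = inner x y - inner x z.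
Proof. exact: linearB. Qed.

Lemma innerZr k x y : inner x (k *: y) = k *: inner x y.
Proof. exact: linearZ. Qed.

Lemma innerZl k x y : inner (k *: x) y = k^*%C *: inner x y.
Proof. by rewrite -inner_star linearZ cstarZ inner_star. Qed.

Lemma inner0l y : inner 0 y = 0.
Proof. by rewrite -(scale0r (0 : E)) innerZl conjc0 scale0r. Qed.

Lemma inner_ractl x a y : inner (ract x a) y = cmul (cstar a) (inner x y).
Proof. by rewrite -inner_star inner_ract cstarM inner_star. Qed.

Lemma nrm_inner x : nrm (inner x x) = nrm x ^+ 2.
Proof. exact/esym/nrm_sqr/norm_inner. Qed.

Lemma inner_eq0 x : (forall y, inner y x = 0) -> x = 0.
Proof.
move=> x0; apply/eqP; rewrite -nrm_eq0 -[nrm x == 0](expf_eq0 _ 2).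
by rewrite -nrm_inner x0 nrm0.
Qed.

Lemma nrm_ract x a : nrm (ract x a) <= nrm x * nrm a.
Proof.
rewrite -(ler_pXn2r (n := 2)) ?nnegrE ?mulr_ge0 ?nrm_ge0//.
rewrite -nrm_inner inner_ractl inner_ract (le_trans (nrmM _ _))//.
rewrite nrm_star exprMn -nrm_inner mulrC [nrm a ^+ 2]expr2 mulrA.
by rewrite ler_wpM2r ?nrm_ge0// nrmM.
Qed.

(* Polarization replaces the Cauchy-Schwarz inequality, whose proof would
   require the order structure of the algebra. *)
Lemma nrm_inner_le x y : nrm (inner x y) <= 6 * (nrm x * nrm y).
Proof.
(* For unit vectors, |u + v|^2 + |u|^2 + |v|^2 <= 4 + 2; this is the source of the constant 6. *)
have sum_le (u v : E) : nrm u = 1 -> nrm v = 1 ->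
      nrm (inner u v + inner v u) <= 6.
  move=> u1 v1; have -> : inner u v + inner v u =
      inner (u + v) (u + v) - (inner u u + inner v v).
    rewrite !innerDl !innerDr [inner v u + _]addrC addrACA [X in X - _]addrC.
    by rewrite addrK.
  rewrite (le_trans (nrmB _ _))// (le_trans (lerD (lexx _) (nrmD _ _)))//.
  rewrite !nrm_inner u1 v1.
  have := nrmD u v; have := nrm_ge0 (u + v); rewrite u1 v1; nra.
have unit_le (u v : E) : nrm u = 1 -> nrm v = 1 -> nrm (inner u v) <= 6.
  move=> u1 v1; rewrite -(ler_pM2l (ltr0n R 2)).
  have iv1 : nrm ('i%C *: v) = 1.
    by rewrite nrmZ normc_def /= expr0n expr1n add0r sqrtr1 mul1r.
  have -> : 2 * nrm (inner u v) = nrm (2 *: inner u v).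
    by rewrite nrmZ normr_nat /= -natr1.
  (* Polarization: the symmetric sums for v and for i v recover 2 <u, v>, each of norm at most 6. *)
  have -> : 2 *: inner u v = (inner u v + inner v u) +
      - 'i%C *: (inner u ('i%C *: v) + inner ('i%C *: v) u).
    rewrite innerZl linearZ/= scalerDr !scalerA mulNr -expr2 sqr_i opprK.
    rewrite scale1r addrACA -mulr2n scaler_nat.
    have -> : - 'i%C * ('i%C)^*%C = -1 :> R[i].
      by apply/eqP; rewrite eq_complex /=; simpc.
    by rewrite scaleN1r subrr addr0.
  rewrite (le_trans (nrmD _ _))// nrmZ normrN normc_def /= expr0n expr1n add0r.
  rewrite sqrtr1 mul1r mulr2n mulrDl mul1r.
  by rewrite lerD ?sum_le.
have [->|x0] := eqVneq x 0.
  by rewrite inner0l !nrm0 mul0r mulr0.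
have [->|y0] := eqVneq y 0; first by rewrite linear0 !nrm0 !mulr0.
have pos (z : E) : z != 0 -> 0 < nrm z.
  by move=> z0; rewrite lt_def nrm_ge0 nrm_eq0 z0.
have nz (z : E) : z != 0 -> nrm ((nrm z)^-1%:C *: z) = 1.
  move=> /pos z0; rewrite nrmZr ger0_norm ?invr_ge0 ?nrm_ge0// mulVf//.
  by rewrite gt_eqF.
have := unit_le _ _ (nz x x0) (nz y y0).
rewrite innerZl conjc_real linearZ/= !nrmZr !ger0_norm ?invr_ge0 ?nrm_ge0//.
rewrite mulrA -invfM mulrC ler_pdivrMr 1?mulrC//.
by rewrite mulr_gt0 ?pos.
Qed.

End HilbertModules.

(** * Lower bounds for 1 + t H^2 and surjectivity by continuation in t *)

(** Here k is purely imaginary: for selfadjoint H the maps 1 + k H and 1 - k H are commuting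
    adjoints of each other. Comparing norms only makes the notion cover right multiplications too,
    which need not be adjointable. *)
Definition skew_isometric (R : realType) (V : normedModType R[i])
    (H : V -> V) : Prop :=
  forall (k : R[i]) w, k^*%C = - k -> nrm (w + k *: H w) = nrm (w - k *: H w).

(* With k = i sqrt t one has 1 + t H^2 = (1 - k H) (1 + k H), and w is the
   average of (1 + k H) w and (1 - k H) w, which have the same norm. *)
Lemma skew_isometric_le (R : realType) (V : normedModType R[i]) (H : V -> V) :
  {morph H : x y / x + y} -> scalable H -> skew_isometric H ->
  forall t w, 0 <= t -> nrm w <= nrm (w + t%:C *: H (H w)).
Proof.
move=> HD HZ iso t w t0; pose k : R[i] := (Num.sqrt t)%:C * 'i%C.
have kN : k^*%C = - k by apply/eqP; rewrite eq_complex /=; simpc.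
have kk : k * k = - t%:C.
  by rewrite mulrACA -expr2 -rmorphXn/= sqr_sqrtr// -expr2 sqr_i mulrN1.
have half v : nrm v <= nrm (v - k *: H v).
  rewrite -(ler_pM2l (ltr0n R 2)) -[2 * nrm v](_ : nrm (v + v) = _); last first.
    by rewrite -mulr2n -scaler_nat nrmZ normr_nat /= -natr1.
  rewrite -[X in nrm (X + _)](addrK (k *: H v)) -addrA [- _ + _]addrC.
  by rewrite (le_trans (nrmD _ _))// iso// mulr2n mulrDl mul1r.
rewrite (le_trans (half w))// -iso// (le_trans (half _))//.
by rewrite HD HZ scalerDr scalerA kk scaleNr opprD opprK addrA addrK.
Qed.

Section Continuation.
Context (R : realType) (V : completeNormedModType R[i]) (G : V -> V) (M : R).
Hypotheses (GB : {morph G : x y / x - y}) (GM : forall x, nrm (G x) <= M * nrm x).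
Hypothesis G_le : forall t w, 0 <= t -> nrm w <= nrm (w + t%:C *: G w).

Let G_eq t x y : 0 <= t -> x + t%:C *: G x = y + t%:C *: G y -> x = y.
Proof.
move=> t0 xy; apply/eqP; rewrite -subr_eq0 -nrm_eq0 eq_le nrm_ge0 andbT.
rewrite (le_trans (G_le _ t0))// GB scalerBr addrACA xy -opprD subrr.
by rewrite nrm0.
Qed.

(* If 1 + t G is invertible then its inverse S satisfies |t G S| <= 2, so that
   1 + s G = (1 + (s - t) G S) (1 + t G) is invertible for s = 5 t / 4. *)
Lemma resolvent_surjective (T : R) : exists t, [/\ T <= t, 0 < t &
  forall y, exists x, x + t%:C *: G x = y].
Proof.
pose P t := 0 < t /\ forall y, exists x, x + t%:C *: G x = y.
have M0 : 0 <= `|M| by [].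
have [t0 [t0_gt0 t0_surj]] : exists t0, P t0.
  (* Start of the continuation: for this t the map t G has norm at most 1/2. *)
  have t0 : 0 < (2 * (`|M| + 1))^-1 by rewrite invr_gt0 mulr_gt0// ltr_wpDl.
  exists (2 * (`|M| + 1))^-1; split=> // y; set t := _^-1 in t0 *.
  have [|x z|x|x xE] := @neumann _ _ (fun x => - (t%:C *: G x)) 2^-1 _ _ _ y.
  - by apply/andP; split; lra.
  - by rewrite GB scalerBr opprB opprK addrC.
  - rewrite nrmN nrmZr gtr0_norm// -ler_pdivlMl// (le_trans (GM x))//.
    rewrite mulrA ler_wpM2r ?nrm_ge0// (le_trans (ler_norm M))// /t invrK.
    by rewrite mulrAC mulfV// mul1r lerDl.
  - by exists x; rewrite {1}xE subrK.
(* Since t G S x = x - S x and |S x| <= |x|, the perturbation (1/4) t G S has norm at most 1/2. This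
   bound does not depend on t, so the ratio 5/4 works at every stage. *)
have step t : P t -> P (t * (5 / 4)).
  move=> [t_gt0 /choice[S SE]]; split=> [|y]; first by rewrite mulr_gt0//; lra.
  have t_ge0 := ltW t_gt0.
  have SB : {morph S : x y / x - y}.
    move=> u v; apply: (G_eq t_ge0).
    by rewrite SE GB scalerBr addrACA -opprD !SE.
  have [|u v|x|w wE] :=
      @neumann _ _ (fun x => - ((4^-1)%:C *: (t%:C *: G (S x)))) 2^-1 _ _ _ y.
  - by apply/andP; split; lra.
  - by rewrite SB GB !scalerBr opprB opprK addrC.
  - rewrite nrmN nrmZr gtr0_norm ?invr_gt0//.
    have -> : t%:C *: G (S x) = x - S x by rewrite -{2}(SE x) addrC addKr.
    have := nrmB x (S x); have := G_le (S x) t_ge0; rewrite SE; lra.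
  - exists (S w); have -> : (t * (5 / 4))%:C = t%:C + (4^-1)%:C * t%:C :> R[i].
      by rewrite -rmorphM -rmorphD; congr (_%:C); field.
    by rewrite scalerDl addrA SE -scalerA {1}wE subrK.
have Pn n : P (t0 * (5 / 4) ^+ n).
  elim: n => [|n IH]; first by rewrite expr0 mulr1.
  by rewrite exprSr (mulrA t0); exact: (step _ IH).
pose n := Num.bound (`|T| / t0 * 4); exists (t0 * (5 / 4) ^+ n).
have [? ?] := Pn n; split=> //; rewrite (le_trans (ler_norm T))//.
(* Bernoulli's inequality shows that the powers of 5/4 eventually pass |T| / t0. *)
have bern m : 1 + m%:R / 4 <= (5 / 4) ^+ m :> R.
  elim: m => [|m IH]; first by rewrite mul0r addr0 expr0.
  rewrite exprS -natr1; have : 0 <= m%:R :> R by []. nra.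
rewrite mulrC -ler_pdivrMr// (le_trans _ (bern n))//.
have : `|T| / t0 * 4 < n%:R.
  by apply: archi_boundP; rewrite mulr_ge0// divr_ge0// ltW.
lra.
Qed.

End Continuation.

(** * Resolvents of h^2 for selfadjoint h *)

Section Resolvents.
Context (R : realType) (A : cstarType R).

(** Positivity <w, w> = c^* c moves the question into A: |w + k w h| = |v| for v = c (1 + k h), and
    v v^* = c (1 - k^2 h^2) c^* is even in k. *)
Lemma skew_isometric_ract (E : hilbertModType A) (h : A) : cstar h = h ->
  skew_isometric (fun w : E => ract w h).
Proof.
move=> hh k w kN; have [c wc] := inner_ge0 w.
have sq k' : k'^*%C = - k' -> nrm (w + k' *: ract w h) ^+ 2 =
    nrm (cmul c (cstar c) - (k' * k') *: cmul (cmul c h) (cmul h (cstar c))).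
  move=> k'N; pose v := c + k' *: cmul c h.
  have -> : nrm (w + k' *: ract w h) = nrm v.
    apply/eqP; rewrite -(eqrXn2 (n := 2)) ?nrm_ge0// -nrm_inner -nrm_starM.
    rewrite /v cstarD cstarZ cstarM hh innerDl !innerDr !innerZl !innerZr wc.
    rewrite !inner_ractl !inner_ract wc hh !cmulDl !linearD/=.
    by rewrite !cmulZl !linearZ/= !cmulA.
  rewrite -nrm_Mstar /v cstarD cstarZ cstarM hh !cmulDl !linearD/= !cmulZl.
  rewrite !linearZ/= k'N !scaleNr [cmul c (cmul h _)]cmulA.
  by rewrite addrA subrK scalerN scalerA.
apply/eqP; rewrite -(eqrXn2 (n := 2)) ?nrm_ge0// -scaleNr !sq// ?mulrNN//.
by rewrite rmorphN /= kN.
Qed.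

(** The cross terms of <w + k H w, w + k H w> cancel, which leaves an expression even in k. *)
Lemma skew_isometric_selfadjoint (E : hilbertModType A) (H : E -> E) :
  is_adjoint H H -> skew_isometric H.
Proof.
move=> HH k w kN.
have sq k' : k'^*%C = - k' -> nrm (w + k' *: H w) ^+ 2 =
    nrm (inner w w - (k' * k') *: inner (H w) (H w)).
  move=> k'N; rewrite -nrm_inner innerDl !innerDr !innerZl !innerZr k'N HH.
  by rewrite !scaleNr addrA addrK scalerA.
apply/eqP; rewrite -(eqrXn2 (n := 2)) ?nrm_ge0// -scaleNr !sq// ?mulrNN//.
by rewrite rmorphN /= kN.
Qed.

Lemma ract_sqr_le (E : hilbertModType A) (h : A) (t : R) (w : E) :
  cstar h = h -> 0 <= t -> nrm w <= nrm (w + t%:C *: ract w (cmul h h)).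
Proof.
move=> hh t0; rewrite ractA.
apply: (skew_isometric_le (H := fun w : E => ract w h)) t0.
- by move=> x y; rewrite ractDl.
- by move=> k x; rewrite ractZl.
- exact: skew_isometric_ract.
Qed.

Lemma theta_adjoint (Y Z : hilbertModType A) (y : Y) (z : Z) :
  is_adjoint (theta z y) (theta y z).
Proof.
by move=> u v; rewrite /theta inner_ractl inner_ract inner_star.
Qed.

(** The two equations express s = t h^2 (1 + t h^2)^-1 without a unit in A. *)
Lemma resolvent (h : A) (T : R) : cstar h = h ->
  exists t s, [/\ T <= t, 0 < t,
    s + t%:C *: cmul s (cmul h h) = t%:C *: cmul h h &
    s + t%:C *: cmul (cmul h h) s = t%:C *: cmul h h].
Proof.
move=> hh; pose g := cmul h h; pose G (a : A) := cmul a g.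
have G_le t w : 0 <= t -> nrm w <= nrm (w + t%:C *: G w).
  exact: (@ract_sqr_le (self_module A)).
have GB : {morph G : x y / x - y} by move=> x y; rewrite /G cmulBl.
have GM x : nrm (G x) <= nrm g * nrm x by rewrite mulrC nrmM.
have [t [Tt t0 surj]] := resolvent_surjective GB GM G_le T.
have [s sE] := surj (t%:C *: g); exists t, s; split=> //.
(* The first equation is surjectivity. For the second, 1 + t G sends s g - g s to the commutator of
   s + t s g = t g with g, which is 0, and 1 + t G is bounded below. *)
rewrite -/g; suff -> : cmul g s = cmul s g by [].
apply/eqP; rewrite eq_sym -subr_eq0 -nrm_eq0 eq_le nrm_ge0 andbT.
rewrite (le_trans (G_le t _ (ltW t0)))// GB /G -[cmul (cmul g s) g]cmulA.

have -> : cmul s g - cmul g s +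
    t%:C *: (cmul (cmul s g) g - cmul g (cmul s g)) =
    cmul (s + t%:C *: cmul s g) g - cmul g (s + t%:C *: cmul s g).
  by rewrite cmulDl cmulZl cmulDr cmulZr !cmulA scalerBr opprD addrACA.
by rewrite sE cmulZl cmulZr subrr nrm0.
Qed.

End Resolvents.

(** * Approximate units from resolvents *)

Section ApproximateUnits.
Context (R : realType) (A : cstarType R).

(** All Hilbert modules are quantified over because the bound is used both in a given module and in
    A itself. *)
Definition contracting (s : A) : Prop :=
  forall (F : hilbertModType A) (w : F), nrm (w - ract w s) <= nrm w.

(** The equation says (1 - s) (1 + t h^2) = 1, so the lower bound for 1 + t h^2 becomes an upper
    bound for 1 - s. *)
Lemma resolvent_contracting (h s : A) (t : R) : cstar h = h -> 0 <= t ->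
  s + t%:C *: cmul s (cmul h h) = t%:C *: cmul h h -> contracting s.
Proof.
move=> hh t0 sE F w; rewrite (le_trans (ract_sqr_le _ hh t0))//.
rewrite ractBl -ractA scalerBr -!ractZr -{1}sE ractDr.
by rewrite addrK subrK.
Qed.

(** At the vector s^* of A, contraction gives |s|^2 = |s^* s| <= 2 |s|. *)
Lemma contracting_le2 (s : A) : contracting s -> nrm s <= 2.
Proof.
move=> cs; have := cs (self_module A) (cstar s).
change (nrm (cstar s - cmul (cstar s) s) <= nrm (cstar s) -> nrm s <= 2).
rewrite nrm_star => le_s.
have : nrm (cmul (cstar s) s) <= nrm s + nrm s.
  rewrite -[cmul _ _](subKr (cstar s)) (le_trans (nrmB _ _))//.
  by rewrite nrm_star lerD.
rewrite nrm_starM; have := nrm_ge0 s; nra.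
Qed.

(** For v = x - x s, |v|^2 = |<v, x> - <v, x> s| <= |<v, x>| by contraction in A, and <v, x> is the
    adjoint of <x, x> - <x, x> s. *)
Lemma contracting_sqr (E : hilbertModType A) (x : E) (s : A) :
  contracting s ->
  nrm (x - ract x s) ^+ 2 <= nrm (inner x x - cmul (inner x x) s).
Proof.
move=> cs; set v := x - ract x s.
rewrite -nrm_inner {2}/v innerBr inner_ract.
have /le_trans := cs (self_module A) (inner v x); apply.
by rewrite -[inner v x]inner_star nrm_star /v innerBr inner_ract.
Qed.

(** The form s = b <x, x> keeps s in every ideal containing <x, x>. The last bound makes 1 minus the
    rank one operator [theta (ract x b) x] a contraction. *)
Lemma approximate_unit (E : hilbertModType A) (x : E) (e : R) : 0 < e ->
  exists b, let s := cmul b (inner x x) in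
    [/\ contracting s, nrm (x - ract x s) < e &
        forall w, nrm (w - ract x (cmul b (inner x w))) <= nrm w].
Proof.
move=> e0; set h := inner x x; have hh : cstar h = h by rewrite inner_star.
(* Two uses of [contracting_sqr] give |x - x s|^4 <= |h - h s|^2 <= |h^2 - h^2 s| = |s| / t <= 2 /
   t, which dictates the size of t. *)
have [t [s [tT t0 sE sE']]] := resolvent (2 / e ^+ 4 + 1) hh.
have cs := resolvent_contracting hh (ltW t0) sE.
(* This is t h (1 + t h^2)^-1, whose product with h is s. *)
exists (t%:C *: (h - cmul s h)).
have -> /= : cmul (t%:C *: (h - cmul s h)) h = s.
  by rewrite cmulZl cmulBl scalerBr -cmulA -sE addrK.
split=> // [|w].
- have hs : nrm (h - cmul h s) ^+ 2 <= 2 / t.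
    have := @contracting_sqr (self_module A) h s cs.
    change (nrm (h - cmul h s) ^+ 2 <=
      nrm (cmul (cstar h) h - cmul (cmul (cstar h) h) s) ->
      nrm (h - cmul h s) ^+ 2 <= 2 / t).
    rewrite hh => /le_trans; apply; rewrite ler_pdivlMr//.
    rewrite -[X in _ * X](gtr0_norm t0) mulrC -nrmZr scalerBr -{1}sE' addrK.
    exact: contracting_le2.
  have := contracting_sqr x cs; rewrite -/h.
  have e4 : 0 < e ^+ 4 by rewrite exprn_gt0.
  have : 2 / t < e ^+ 4.
    rewrite ltr_pdivrMr// mulrC -ltr_pdivrMr//; lra.
  have := nrm_ge0 (x - ract x s); have := nrm_ge0 (h - cmul h s).
  move: (nrm (x - _)) (nrm (h - _)) hs => p q q2 q0 p0 te pq.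
  rewrite -(ltr_pXn2r (n := 4)) ?nnegrE ?(ltW e0)//.
  have -> : p ^+ 4 = (p ^+ 2) ^+ 2 by rewrite -exprM.
  rewrite (le_lt_trans _ te)// (le_trans _ q2)// ler_pXn2r// nnegrE exprn_ge0//.
- set b := t%:C *: _; have bE : b + t%:C *: cmul (cmul h h) b = t%:C *: h.
    rewrite /b cmulZr -scalerDr cmulBr cmulA scalerBr.
    have -> : h - cmul s h + (t%:C *: cmul (cmul h h) h -
        t%:C *: cmul (cmul (cmul h h) s) h) = h - cmul (s + t%:C *:
        cmul (cmul h h) s - t%:C *: cmul h h) h.
      by rewrite cmulBl cmulDl !cmulZl opprB opprD [RHS]addrA addrACA.
    by rewrite sE' subrr cmul0l subr0.
  (* With H = [theta x x], selfadjoint, w' solves w' + t H^2 w' = w, so the lower bound for 1 + t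
     H^2 gives |w'| <= |w|. *)
  set w' := w - _.
  have H_adj : is_adjoint (theta x x) (theta x x) by apply: theta_adjoint.
  have HD : {morph theta x x : y z / y + z}.
    by move=> y z; rewrite /theta innerDr ractDr.
  have HZ : scalable (theta x x) by move=> k y; rewrite /theta innerZr ractZr.
  have := skew_isometric_le HD HZ (skew_isometric_selfadjoint H_adj) w' (ltW t0).
  move=> /le_trans; apply; rewrite le_eqVlt; apply/orP; left; apply/eqP.
  congr nrm; rewrite /theta !inner_ract -/h -ractZr.
  have -> : t%:C *: cmul h (inner x w') = cmul b (inner x w).
    rewrite /w' innerBr inner_ract -/h cmulBr !cmulA scalerBr.
    by rewrite -[b in RHS](addrK (t%:C *: cmul (cmul h h) b)) bE cmulBl !cmulZl.
  by rewrite subrK.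
Qed.


End ApproximateUnits.

(** * Closed ideals and Cohen factorization *)

Section Factorization.
Context (R : realType) (A : cstarType R) (I : set A).
Hypothesis I_ideal : cstar_ideal I.

Lemma ideal0 : I 0.
Proof. by case: I_ideal => [[]]. Qed.

Lemma idealZD k a b : I a -> I b -> I (k *: a + b).
Proof. by case: I_ideal => [[_]] + _ _ _; apply. Qed.

Lemma idealD a b : I a -> I b -> I (a + b).
Proof. by move=> /(idealZD 1)/[apply]; rewrite scale1r. Qed.

Lemma idealZ k a : I a -> I (k *: a).
Proof. by move=> /(idealZD k)/(_ ideal0); rewrite addr0. Qed.

Lemma idealB a b : I a -> I b -> I (a - b).
Proof. by move=> Ia /(idealZ (-1)); rewrite scaleN1r; apply: idealD. Qed.

Lemma idealMl a b : I b -> I (cmul a b).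
Proof. by case: I_ideal => _ _ + _; apply. Qed.

Lemma idealMr a b : I a -> I (cmul a b).
Proof. by case: I_ideal => _ _ _; apply. Qed.

Lemma ideal_closed a :
  (forall e : R, 0 < e -> exists2 b, I b & nrm (a - b) < e) -> I a.
Proof. by case: I_ideal => _ cI _ _; apply: closed_nrm. Qed.

(** An approximate unit s = b a a^* for the vector a^* gives approximants a^* b a a^*, which contain
    the factor a and so lie in I. *)
Lemma ideal_star a : I a -> I (cstar a).
Proof.
move=> Ia; apply: ideal_closed => e e0.
have [b [_ ab _]] := @approximate_unit R A (self_module A) (cstar a) e e0.
exists (cmul (cstar a) (cmul b (cmul (cstar (cstar a)) (cstar a)))) => //.
by rewrite cstarK; apply/idealMl/idealMl/idealMr.
Qed.

(* Cohen's argument: j is the limit of j_n = sum_(k <= n) 2^-k s_k for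
   approximate units s_k in I, and z is the limit of the solutions z_n of
   2^-n z_n + z_n j_n = x; choosing s_(n+1) so that z_n s_(n+1) is close to z_n
   makes z_n a Cauchy sequence. *)
Lemma cohen_factorization (E : hilbertModType A) (x : E) :
  (forall y, I (inner y x)) -> exists z j, I j /\ x = ract z j.
Proof.
move=> Ix; pose d n : R := 2^-1 ^+ n.
have dS n : d n = d n.+1 + d n.+1 by rewrite /d exprS; field.
have d0 n : 0 < d n by rewrite exprn_gt0// invr_gt0.
have d1 n : d n <= 1 by rewrite exprn_ile1//; lra.
(* The middle clause bounds 1 - (d_n + j_n) by 1 - d_n; in this form it passes to n + 1 and makes
   the Neumann series converge. *)
pose solves n (p : E * A) := [/\ I p.2,
  forall w : E, nrm (w - (d n)%:C *: w - ract w p.2) <= (1 - d n) * nrm w &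
  (d n)%:C *: p.1 + ract p.1 p.2 = x].
have step (np : nat * (E * A)) : exists p, solves np.1 np.2 ->
    [/\ solves np.1.+1 p, nrm (p.1 - np.2.1) <= d np.1 &
        nrm (p.2 - np.2.2) <= d np.1].
  case: np => n [z j] /=.
  have [[/= Ij zj xE]|] := pselect (solves n (z, j)); last by exists (z, j).
  (* As z = (x - z j) / d_n, its inner products stay in I, and hence so does the next approximate
     unit. *)
  have Iz y : I (inner y z).
    have -> : z = (d n)^-1%:C *: (x - ract z j).
      by rewrite -xE addrK scalerA -rmorphM mulVf ?scale1r// gt_eqF.
    by rewrite innerZr innerBr; apply/idealZ/idealB; rewrite ?inner_ract//;
       apply: idealMl.
  have [b [cs zs _]] := approximate_unit z (d0 n).
  set s := cmul b (inner z z) in cs zs.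
  pose j' := j + (d n.+1)%:C *: s.
  pose f w : E := w - (d n.+1)%:C *: w - ract w j'.
  (* Because d_n = 2 d_(n+1), the new map is the old one plus d_(n+1) (1 - s), so its bound is (1 -
     d_n) + d_(n+1) = 1 - d_(n+1). *)
  have fE w : f w = (w - (d n)%:C *: w - ract w j) +
      (d n.+1)%:C *: (w - ract w s).
    rewrite /f /j' ractDr ractZr (dS n) rmorphD scalerDl scalerBr !opprD !addrA.
    by congr (_ - _); rewrite [RHS]addrAC subrK.
  have f_le w : nrm (f w) <= (1 - d n.+1) * nrm w.
    rewrite fE (le_trans (nrmD _ _))// (le_trans (lerD (zj w) (lexx _)))//.
    rewrite nrmZr gtr0_norm//.
    rewrite (le_trans (lerD (lexx _) (ler_wpM2l (ltW (d0 _)) (cs E w))))//.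
    by rewrite -mulrDl (dS n) opprD addrA subrK.
  have fB : {morph f : u v / u - v}.
    have sub4 (p q r t : E) : (p - q) - (r - t) = (p - r) - (q - t).
      by rewrite !opprD !opprK addrACA.
    move=> u v; rewrite /f scalerBr ractBl (sub4 u v); apply: sub4.
  have [|z' z'E] := neumann _ fB f_le x.
    by rewrite subr_ge0 d1 ltrBlDr ltrDl d0.
  have {}z'E : (d n.+1)%:C *: z' + ract z' j' = x.
    apply: (addIr (f z')); rewrite -z'E /f -[z' - _ - _]addrA -opprD.
    by rewrite [LHS]addrC subrK.
  exists (z', j') => _ /=; split=> //.
  - split=> //=; apply: idealD => //; apply/idealZ/idealMl/Iz.
  - set v := z' - z.
    (* The increment v satisfies (d_(n+1) + j') v = d_(n+1) (z - z s), the operators acting from the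
       right; hence |v| <= |z - z s| < d_n. *)
    have vE : v = f v + (d n.+1)%:C *: (z - ract z s).
      have -> : (d n.+1)%:C *: (z - ract z s) =
          (d n.+1)%:C *: v + ract v j'.
        rewrite /v [in RHS]scalerBr ractBl [RHS]addrACA z'E -opprD -xE /=.
        rewrite /j' ractDr ractZr (dS n) rmorphD scalerDl -(addrA _ _ (ract z j)).
        by rewrite opprD addrACA subrr add0r opprD addrA addrK scalerBr.
      by rewrite /f -[v - _ - _]addrA -opprD subrK.
    have := nrmD (f v) ((d n.+1)%:C *: (z - ract z s)); rewrite -vE.
    rewrite nrmZr gtr0_norm//; have := f_le v; have := d0 n.+1.
    move: (nrm v) (nrm (f v)) (nrm (z - _)) zs => p q r; nra.
  - rewrite /j' addrAC subrr add0r nrmZr gtr0_norm// (dS n).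
    have := contracting_le2 cs; have := d0 n.+1; nra.
have [f fP] := choice step.
pose u := fix u n : E * A := if n is m.+1 then f (m, u m) else (x, 0).
have uP n : solves n (u n).
  elim: n => [|n IH]; last by case: (fP (n, u n) IH).
  split=> [|w|] /=; first exact: ideal0.
  - by rewrite /d expr0 scale1r !subrr mul0r linear0 subr0 nrm0.
  - by rewrite /d expr0 scale1r linear0 addr0.
have uS n := fP (n, u n) (uP n).
have half : 0 <= (2^-1 : R) < 1 by apply/andP; split; lra.
have lim (V : completeNormedModType R[i]) (v : nat -> V) :
    (forall n, nrm (v n.+1 - v n) <= d n) ->
    exists l, forall n, nrm (l - v n) <= 2 * d n.
  move=> vS; have [n|l lv] := @geometric_cvg _ _ v _ _ ler01 half.
    by rewrite mul1r.
  exists l => n; rewrite (le_trans (lv n))// mul1r le_eqVlt.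
  by apply/orP; left; apply/eqP; rewrite /d; field.
have [n|z zP] := lim E (fun n => (u n).1); first by case: (uS n).
have [n|j jP] := lim A (fun n => (u n).2); first by case: (uS n).
exists z, j; split.
  apply: ideal_closed => e /(geometric_lt (ler0n R 2) half)[n ne].
  exists (u n).2; first by case: (uP n).
  exact: le_lt_trans (jP n) ne.
apply/eqP; rewrite -subr_eq0; apply/eqP; apply: nrm_le0 => e e0.
(* This collects d_n |z_n|, |z - z_n| |j_n| and |z| |j - j_n|, where |z_n| <= |z| + 2 and |j_n| <=
   |j| + 2. *)
pose c := nrm z * 3 + 2 + 2 * (nrm j + 2).
have c0 : 0 <= c.
  by rewrite /c; have := nrm_ge0 z; have := nrm_ge0 j; lra.
have [n ne] := geometric_lt c0 half e0; apply: le_trans (ltW ne).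
have [_ _ <-] := uP n; have := zP n; have := jP n.
case: (u n) => zn jn /= jz zz.
have -> : (d n)%:C *: zn + ract zn jn - ract z j =
    (d n)%:C *: zn + (ract (zn - z) jn + ract z (jn - j)).
  by rewrite ractBl ractBr -addrA; congr (_ + _); rewrite addrA subrK.
have zn_le : nrm zn <= nrm z + 2 * d n.
  by rewrite -[X in nrm X](subKr z) (le_trans (nrmB _ _))// lerD2l.
have jn_le : nrm jn <= nrm j + 2 * d n.
  by rewrite -[X in nrm X](subKr j) (le_trans (nrmB _ _))// lerD2l.
rewrite (le_trans (nrmD _ _))// (le_trans (lerD (lexx _) (nrmD _ _)))//.
rewrite nrmZr gtr0_norm//.
rewrite (le_trans (lerD (lexx _) (lerD (nrm_ract _ _) (nrm_ract _ _))))//.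
rewrite -/(d n) nrmBC [nrm (jn - j)]nrmBC /c.
have := d0 n; have := nrm_ge0 z; have := nrm_ge0 j; have := nrm_ge0 jn.
have := nrm_ge0 (z - zn).
move: (d n) (nrm z) (nrm j) (nrm jn) (nrm zn) (nrm (z - zn)) (nrm (j - jn))
  jz zz zn_le jn_le (d1 n).
move=> D Z J Jn Zn p q qD pD ZnD JnD D1 p0 Jn0 J0 Z0 D0.
have : D * Zn <= D * (Z + 2) by rewrite ler_wpM2l//; lra.
have : p * Jn <= 2 * D * (J + 2) by apply: ler_pM => //; lra.
have : Z * q <= Z * (2 * D) by rewrite ler_wpM2l.
lra.
Qed.
End Factorization.

(** * Linear spans *)

Section LinearSpan.
Context (R : realType) (V : lmodType R[i]).

Lemma sub_linspan (S : set V) : S `<=` linspan S.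
Proof.
move=> x Sx; exists 1%N, (fun=> 1), (fun=> x); split=> //.
by rewrite big_ord1 scale1r.
Qed.

Lemma subspace_linspan (S : set V) : subspace (linspan S).
Proof.
split.
  exists 0%N, (fun=> 0), (fun=> 0); split; last by rewrite big_ord0.
  by case.
move=> k _ _ [n [c [s [Ss ->]]]] [m [d [t [St ->]]]].
exists (n + m)%N, (fun i : 'I_(n + m) =>
    match fintype.split i with inl j => k * c j | inr j => d j end),
  (fun i : 'I_(n + m) =>
    match fintype.split i with inl j => s j | inr j => t j end).
split=> [i|]; first by case: (fintype.split i).
rewrite big_split_ord/=; congr (_ + _).
  rewrite scaler_sumr; apply: eq_bigr => i _; rewrite scalerA.
  by have := unsplitK (inl i : 'I_n + 'I_m) => /= ->.
apply: eq_bigr => i _.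
by have := unsplitK (inr i : 'I_n + 'I_m) => /= ->.
Qed.

Lemma linspan_le (S U : set V) : subspace U -> S `<=` U -> linspan S `<=` U.
Proof.
move=> [U0 UZD] SU _ [n [k [s [Ss ->]]]].
elim/big_ind: _ => // [x y Ux Uy|i _].
  by rewrite -[x]scale1r; apply: UZD.
by rewrite -[_ *: _]addr0; apply: UZD => //; apply: SU.
Qed.

End LinearSpan.

(** * Adjointable maps and operator norm closures *)

Section AdjointableMaps.
Context (R : realType) (A : cstarType R).
Implicit Types Y Z W : hilbertModType A.

Lemma is_adjoint_sym Y Z (T : Y -> Z) (S : Z -> Y) :
  is_adjoint T S -> is_adjoint S T.
Proof. by move=> TS y z; rewrite -inner_star -TS inner_star. Qed.

Lemma adjointable_linear Y Z (T : Y -> Z) : adjointable T ->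
  forall k x y, T (k *: x + y) = k *: T x + T y.
Proof.
move=> [S TS] k x y; apply/eqP; rewrite -subr_eq0; apply/eqP/inner_eq0 => z.
rewrite innerBr innerDr innerZr -!(is_adjoint_sym TS z).
by rewrite innerDr innerZr subrr.
Qed.

Lemma adjointableB Y Z (T : Y -> Z) : adjointable T ->
  {morph T : x y / x - y}.
Proof.
move=> /adjointable_linear TL x y.
by rewrite addrC -scaleN1r TL scaleN1r addrC.
Qed.

Lemma adjointable0 Y Z (T : Y -> Z) : adjointable T -> T 0 = 0.
Proof. by move=> aT; rewrite -(subrr 0) adjointableB// subrr. Qed.

Lemma adjointableZ Y Z (T : Y -> Z) : adjointable T -> scalable T.
Proof.
move=> aT k x.
by rewrite -[k *: x]addr0 adjointable_linear// adjointable0// addr0.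
Qed.

Lemma adjointable_ract Y Z (T : Y -> Z) : adjointable T ->
  forall y a, T (ract y a) = ract (T y) a.
Proof.
move=> [S TS] y a; apply/eqP; rewrite -subr_eq0; apply/eqP/inner_eq0 => z.
by rewrite innerBr inner_ract -!(is_adjoint_sym TS z) inner_ract subrr.
Qed.

Lemma subspace_adjointable Y Z : subspace (@adjointable R A Y Z).
Proof.
split.
  by exists (fun=> 0) => y z; rewrite [0 in LHS]/0 /= inner0l linear0.
move=> k T T' [S TS] [S' TS']; exists (fun z => k^*%C *: S z + S' z) => y z.
by rewrite [X in inner X]/= innerDl innerZl innerDr innerZr TS TS'.
Qed.

Lemma adjointable_comp Y Z W (T : Z -> W) (S : Y -> Z) :
  adjointable T -> adjointable S -> adjointable (T \o S).
Proof.
by move=> [T' TT] [S' SS]; exists (S' \o T') => y w; rewrite /= TT SS.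
Qed.

Lemma adjointable_theta Y Z (z : Z) (y : Y) : adjointable (theta z y).
Proof. by exists (theta y z); apply: theta_adjoint. Qed.

Definition op_bounded Y Z (T : Y -> Z) : Prop :=
  exists2 M : R, 0 <= M & forall y, nrm (T y) <= M * nrm y.

Lemma subspace_op_bounded Y Z : subspace (@op_bounded Y Z).
Proof.
split; first by exists 0 => // y; rewrite mul0r nrm0.
move=> k T T' [M M0 TM] [M' M'0 TM']; have k0 : 0 <= complex.Re `|k|.
  by rewrite -ler0c RRe_real ?normr_real.
exists (complex.Re `|k| * M + M') => [|y]; first by rewrite addr_ge0 ?mulr_ge0.
rewrite (le_trans (nrmD _ _))// mulrDl lerD// nrmZ -mulrA.
by rewrite ler_wpM2l.
Qed.

Lemma op_bounded_theta Y Z (z : Z) (y : Y) : op_bounded (theta z y).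
Proof.
exists (6 * (nrm z * nrm y)) => [|w]; first by rewrite !mulr_ge0 ?nrm_ge0.
rewrite (le_trans (nrm_ract _ _))//.
rewrite (le_trans (ler_wpM2l (nrm_ge0 _) (nrm_inner_le _ _)))//.
by rewrite le_eqVlt; apply/orP; left; apply/eqP; ring.
Qed.

Lemma opnorm_ub Y Z (T : Y -> Z) (e : R) : scalable T ->
  (opnorm T < e%:E)%E -> forall y, nrm (T y) <= e * nrm y.
Proof.
move=> TZ Te y.
have Te1 u : nrm u = 1 -> nrm (T u) <= e.
  move=> u1; rewrite -lee_fin (le_trans _ (ltW Te))//.
  apply: ereal_sup_ubound; exists u => //=.
  by rewrite -nrmE u1.
have [->|y0] := eqVneq y 0.
  by rewrite -(scale0r (0 : Y)) TZ !scale0r !nrm0 mulr0.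
have ny : 0 < nrm y by rewrite lt_def nrm_ge0 nrm_eq0 y0.
have := Te1 ((nrm y)^-1%:C *: y); rewrite TZ !nrmZr gtr0_norm ?invr_gt0//.
by rewrite mulVf ?gt_eqF// => /(_ erefl); rewrite ler_pdivrMl// mulrC.
Qed.

Lemma opnorm_le Y Z (T : Y -> Z) (e : R) : 0 <= e ->
  (forall y, nrm (T y) <= e * nrm y) -> (opnorm T <= e%:E)%E.
Proof.
move=> e0 Te; apply: ub_ereal_sup => _ [y /= y1 <-]; rewrite lee_fin.
by rewrite (le_trans (Te y))// ler_piMr// -lecR nrmE.
Qed.

(** Pointwise bounds replace the supremum in the extended reals. The way back halves e, since a
    pointwise bound only yields a weak inequality for the supremum. *)
Lemma opclosureP Y Z (S : set (Y -> Z)) (T : Y -> Z) :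
  S `<=` adjointable (Z:=Z) ->
  opclosure S T <-> adjointable T /\ forall e : R, 0 < e ->
    exists2 T', S T' & forall y, nrm (T y - T' y) <= e * nrm y.
Proof.
move=> Sadj; split=> -[aT ST]; split=> // e e0.
  have [T' ST' TT'] := ST e e0; exists T' => // y.
  suff /opnorm_ub/(_ TT') : scalable (T - T')%R by apply.
  move=> k x; rewrite -[LHS]/(T (k *: x) - T' (k *: x)).
  by rewrite (adjointableZ aT) (adjointableZ (Sadj _ ST')) -scalerBr.
have e2 : 0 < e / 2 by rewrite divr_gt0.
have [T' ST' TT'] := ST _ e2; exists T' => //.
rewrite (le_lt_trans (opnorm_le (ltW e2) TT'))// lte_fin; lra.
Qed.

Lemma sub_opclosure Y Z (S : set (Y -> Z)) :
  S `<=` adjointable (Z:=Z) -> S `<=` opclosure S.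
Proof.
move=> Sadj T ST; apply/opclosureP => //; split=> [|e e0]; first exact: Sadj.
by exists T => // y; rewrite subrr nrm0 mulr_ge0 ?nrm_ge0// ltW.
Qed.

Lemma opclosed_opclosure Y Z (S : set (Y -> Z)) :
  S `<=` adjointable (Z:=Z) -> opclosed (opclosure S).
Proof.
move=> Sadj T /opclosureP[|aT TS]; first by move=> ? [].
apply/opclosureP => //; split=> // e e0; have e2 : 0 < e / 2 by rewrite divr_gt0.
have [T' /opclosureP[//|_ /(_ _ e2)[T'' ST'' T'T'']] TT'] := TS _ e2.
exists T'' => // y; rewrite -(subrKA (T' y)) (le_trans (nrmD _ _))//.
have := TT' y; have := T'T'' y; lra.
Qed.

Lemma subspace_opclosure Y Z (S : set (Y -> Z)) :
  S `<=` adjointable (Z:=Z) -> subspace S -> subspace (opclosure S).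
Proof.
move=> Sadj [S0 SZD]; split; first exact: sub_opclosure.
move=> k T U /opclosureP[//|aT TS] /opclosureP[//|aU US].
apply/opclosureP => //; split=> [|e e0].
  by case: (subspace_adjointable Y Z) => _; apply.
set m := complex.Re `|k|; have m0 : 0 <= m.
  by rewrite -ler0c RRe_real ?normr_real.
have e1 : 0 < e / (2 * (m + 1)) by rewrite divr_gt0// mulr_gt0// ltr_wpDl.
have e2 : 0 < e / 2 by rewrite divr_gt0.
have [T' ST' TT'] := TS _ e1; have [U' SU' UU'] := US _ e2.
exists (k *: T' + U') => [|y]; first exact: SZD.
rewrite -[X in nrm X]/((k *: T y + U y) - (k *: T' y + U' y)) opprD addrACA.
rewrite -scalerBr (le_trans (nrmD _ _))// nrmZ -/m.
have := ler_wpM2l m0 (TT' y); have := UU' y; have := nrm_ge0 y.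
have : m * (e / (2 * (m + 1))) <= e / 2.
  rewrite mulrA ler_pdivrMr; last by rewrite mulr_gt0// ltr_wpDl.
  by rewrite mulrA divfK//; nra.
move: (nrm y) => q h q0 hU; rewrite mulrA => hT.
have := ler_wpM2r q0 h; nra.
Qed.

End AdjointableMaps.

(** * Finite rank and compact operators *)

Section Compacts.
Context (R : realType) (A : cstarType R).
Implicit Types Y Z W : hilbertModType A.

Definition finite_rank Y Z (P : set Z) : set (Y -> Z) :=
  linspan [set theta z y | z in P & y in [set: Y]].

Lemma finite_rank_theta Y Z (P : set Z) (z : Z) (y : Y) :
  P z -> finite_rank P (theta z y).
Proof. by move=> Pz; apply: sub_linspan; exists z => //; exists y. Qed.

Lemma subspace_finite_rank Y Z (P : set Z) : subspace (@finite_rank Y Z P).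
Proof. exact: subspace_linspan. Qed.

Lemma finite_rank_min Y Z (P : set Z) (U : set (Y -> Z)) : subspace U ->
  (forall z y, P z -> U (theta z y)) -> finite_rank P `<=` U.
Proof.
by move=> sU Uth; apply: linspan_le => // _ [z Pz [y _ <-]]; apply: Uth.
Qed.

Lemma finite_rank_adjointable Y Z (P : set Z) :
  finite_rank P `<=` @adjointable R A Y Z.
Proof.
apply: finite_rank_min; first exact: subspace_adjointable.
by move=> *; apply: adjointable_theta.
Qed.

Lemma finite_rank_bounded Y Z (P : set Z) :
  finite_rank P `<=` @op_bounded R A Y Z.
Proof.
apply: finite_rank_min; first exact: subspace_op_bounded.
by move=> *; apply: op_bounded_theta.
Qed.

Lemma compacts_inP Y Z (P : set Z) (T : Y -> Z) :
  compacts_in P T <-> adjointable T /\ forall e : R, 0 < e ->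
    exists2 T', finite_rank P T' & forall y, nrm (T y - T' y) <= e * nrm y.
Proof. exact/opclosureP/finite_rank_adjointable. Qed.

Lemma finite_rank_compacts Y Z (P : set Z) :
  @finite_rank Y Z P `<=` compacts_in P.
Proof. exact/sub_opclosure/finite_rank_adjointable. Qed.

Lemma compacts_in_theta Y Z (P : set Z) (z : Z) (y : Y) :
  P z -> compacts_in P (theta z y).
Proof. by move=> Pz; apply/finite_rank_compacts/finite_rank_theta. Qed.

Lemma compacts_in_adjointable Y Z (P : set Z) :
  compacts_in P `<=` @adjointable R A Y Z.
Proof. by move=> T []. Qed.

Lemma compacts_in_sub Y Z (P Q : set Z) : P `<=` Q ->
  @compacts_in R A Y Z P `<=` compacts_in Q.
Proof.
move=> PQ T /compacts_inP[aT TP]; apply/compacts_inP; split=> // e /TP[T' T'P].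
exists T' => //; apply: finite_rank_min T'P; first exact: subspace_finite_rank.
by move=> z y /PQ; apply: finite_rank_theta.
Qed.

Lemma subspace_compacts_in Y Z (P : set Z) :
  subspace (@compacts_in R A Y Z P).
Proof.
apply: subspace_opclosure; first exact: finite_rank_adjointable.
exact: subspace_linspan.
Qed.

Lemma opclosed_compacts_in Y Z (P : set Z) : opclosed (@compacts_in R A Y Z P).
Proof. exact/opclosed_opclosure/finite_rank_adjointable. Qed.

Lemma compacts_in_min Y Z (P : set Z) (U : set (Y -> Z)) :
  subspace U -> opclosed U -> (forall z y, P z -> U (theta z y)) ->
  compacts_in P `<=` U.
Proof.
move=> sU cU Uth T [aT TP]; apply: cU; split=> // e /TP[T' T'P TT'].
by exists T' => //; apply: finite_rank_min T'P.
Qed.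

Lemma compacts_in_bounded Y Z (P : set Z) :
  compacts_in P `<=` @op_bounded R A Y Z.
Proof.
move=> T /compacts_inP[aT /(_ 1 ltr01)[T' /finite_rank_bounded[M M0 T'M] TT']].
exists (1 + M) => [|y]; first by rewrite addr_ge0.
rewrite -[T y](subrK (T' y)) (le_trans (nrmD _ _))// mulrDl lerD//.
Qed.

Lemma finite_rank_comp Y Z W (P : set Z) (Q : set W) (T : Z -> W) (S : Y -> Z) :
  adjointable T -> (forall z, P z -> Q (T z)) -> finite_rank P S ->
  finite_rank Q (T \o S).
Proof.
move=> aT TPQ; move: S.
apply: (@finite_rank_min _ _ _ (fun S => finite_rank Q (T \o S))).
  have [W0 WZD] := subspace_finite_rank Y Q.
  split=> [|k S S' QS QS'].
    have -> : T \o 0 = 0 :> (Y -> W); last by [].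
    by apply/funext => y; apply: adjointable0.
  have -> : T \o (k *: S + S') = k *: (T \o S) + (T \o S'); last exact: WZD.
  by apply/funext => y; apply: adjointable_linear.
move=> z y /TPQ QTz; have -> : T \o theta z y = theta (T z) y.
  by apply/funext => w /=; rewrite /theta adjointable_ract.
exact: finite_rank_theta.
Qed.

Lemma theta_comp Y Z W (z : W) (y : Z) (T : Y -> Z) (S : Z -> Y) :
  is_adjoint T S -> theta z y \o T = theta z (S y).
Proof.
by move=> TS; apply/funext => w; rewrite /theta /= -(is_adjoint_sym TS).
Qed.

Lemma finite_rank_compr Y Z W (P : set W) (T : Z -> W) (S : Y -> Z) :
  adjointable S -> finite_rank P T -> finite_rank P (T \o S).
Proof.
move=> [S' SS']; move: T.
apply: (@finite_rank_min _ _ _ (fun T => finite_rank P (T \o S))).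
  have [W0 WZD] := subspace_finite_rank Y P.
  by split=> // k T T'; apply: WZD.
by move=> w z Pw; rewrite (theta_comp _ _ SS'); apply: finite_rank_theta.
Qed.

Lemma compacts_in_comp Y Z W (P : set Z) (Q : set W) (T : Z -> W) (S : Y -> Z) :
  adjointable T -> op_bounded T -> (forall z, P z -> Q (T z)) ->
  compacts_in P S -> compacts_in Q (T \o S).
Proof.
move=> aT [M M0 TM] TPQ /compacts_inP[aS SP]; apply/compacts_inP.
split=> [|e e0]; first exact: adjointable_comp.
have e1 : 0 < e / (M + 1) by rewrite divr_gt0// ltr_wpDl.
have [S' S'P SS'] := SP _ e1.
exists (T \o S') => [|y]; first exact: finite_rank_comp S'P.
rewrite /= -adjointableB// (le_trans (TM _))//.
rewrite (le_trans (ler_wpM2l M0 (SS' y)))// mulrA ler_wpM2r ?nrm_ge0//.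
by rewrite mulrA ler_pdivrMr ?ltr_wpDl// mulrDr mulr1 mulrC lerDl ltW.
Qed.

Lemma compacts_in_compr Y Z W (P : set W) (T : Z -> W) (S : Y -> Z) :
  adjointable S -> op_bounded S -> compacts_in P T -> compacts_in P (T \o S).
Proof.
move=> aS [M M0 SM] /compacts_inP[aT TP]; apply/compacts_inP.
split=> [|e e0]; first exact: adjointable_comp.
have e1 : 0 < e / (M + 1) by rewrite divr_gt0// ltr_wpDl.
have [T' T'P TT'] := TP _ e1.
exists (T' \o S) => [|y]; first exact: finite_rank_compr.
rewrite /= (le_trans (TT' _))// (le_trans (ler_wpM2l (ltW e1) (SM y)))//.
rewrite mulrA ler_wpM2r ?nrm_ge0//.
by rewrite mulrAC ler_pdivrMr ?ltr_wpDl// mulrDr mulr1 lerDl ltW.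
Qed.

(* The factors 1 - k_i are contractions, so that composing them does not undo
   the approximation obtained for the vectors treated before. *)
Lemma finite_rank_unit Z (s : seq Z) (e : R) : 0 < e -> exists k : Z -> Z,
  [/\ finite_rank [set: Z] k, forall w, nrm (w - k w) <= nrm w &
      forall z, z \in s -> nrm (z - k z) <= e].
Proof.
move=> e0; elim: s => [|z s [k [kF k1 ks]]].
  exists 0; split=> [|w|//]; last by rewrite subr0.
  by case: (subspace_finite_rank Z [set: Z]).
have ak := finite_rank_adjointable kF.
set z' := z - k z; have [b [_ z'b cb]] := approximate_unit z' e0.
pose l : Z -> Z := theta (ract z' b) z'.
have lE w : l w = ract z' (cmul b (inner z' w)) by rewrite ractA.
have al : adjointable l by apply: adjointable_theta.
have lF : finite_rank [set: Z] l by apply: finite_rank_theta.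
have [F0 FZD] := subspace_finite_rank Z [set: Z].
(* The witness is k + l - l k, so that 1 minus it factors as (1 - l) (1 - k); the scalars -1 and 1
   match the shape of [FZD]. *)
have E w : w - (-1 *: (l \o k) + (1 *: l + k)) w = (w - k w) - l (w - k w).
  rewrite adjointableB// -[LHS]/(w - (-1 *: l (k w) + (1 *: l w + k w))).
  rewrite scaleN1r scale1r !opprD !opprK -[RHS]addrA; congr (_ + _).
  by rewrite addrA [RHS]addrC; congr (_ + _); apply: addrC.
exists (-1 *: (l \o k) + (1 *: l + k)); split=> [|w|w].
- apply: (FZD); last exact: (FZD).
  by apply: finite_rank_comp kF.
- by rewrite E lE (le_trans (cb _)).
- rewrite inE E lE => /orP[/eqP->|ws]; first by rewrite -/z' ltW.
  by rewrite (le_trans (cb _))// ks.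
Qed.

(** For a finite rank T' near T, 1 - k is small on the finitely many vectors that span the range of
    T', and being a contraction it keeps T - T' small. *)
Lemma compacts_approx Y Z (T : Y -> Z) (e : R) : compacts T -> 0 < e ->
  exists2 k : Z -> Z, finite_rank [set: Z] k &
    forall y, nrm (T y - k (T y)) <= e * nrm y.
Proof.
move=> /compacts_inP[aT TF] e0; have e2 : 0 < e / 2 by rewrite divr_gt0.
have [T' [n [c [s [sP T'E]]]] TT'] := TF _ e2.
have /choice[zy zyE] : forall i, exists zy : Z * Y, s i = theta zy.1 zy.2.
  by move=> i; have [z _ [y _ <-]] := sP i; exists (z, y).
(* C bounds the coefficients of T', the 6 coming from [nrm_inner_le]; dividing by C + 1 below covers
   C = 0. *)
pose C := \sum_(i < n) complex.Re `|c i| * (6 * nrm (zy i).2).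
have m0 i : 0 <= complex.Re `|c i| by rewrite -ler0c RRe_real ?normr_real.
have C0 : 0 <= C.
  by apply: sumr_ge0 => i _; rewrite !mulr_ge0 ?nrm_ge0.
have d0 : 0 < e / (2 * (C + 1)) by rewrite divr_gt0// mulr_gt0// ltr_wpDl.
have [k [kF k1 kz]] := finite_rank_unit [seq (zy i).1 | i <- enum 'I_n] d0.
have ak := finite_rank_adjointable kF.
exists k => // y.
have -> : T y - k (T y) = (T y - T' y - k (T y - T' y)) + (T' y - k (T' y)).
  by rewrite (adjointableB ak) opprB addrAC !subrKA.
have -> : e * nrm y = e / 2 * nrm y + e / 2 * nrm y by field.
rewrite (le_trans (nrmD _ _))// lerD ?(le_trans (k1 _) (TT' _))//.
have T'yE : T' y = \sum_(i < n) c i *: ract (zy i).1 (inner (zy i).2 y).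
  rewrite T'E fct_sumE; apply: eq_bigr => i _.
  by rewrite -[LHS]/(c i *: s i y) zyE.
have -> : T' y - k (T' y) =
    \sum_(i < n) c i *: ract ((zy i).1 - k (zy i).1) (inner (zy i).2 y).
  have kL : {morph k : u v / u + v}.
    by move=> u v; rewrite -[u in LHS]scale1r adjointable_linear// scale1r.
  rewrite T'yE (big_morph k kL (adjointable0 ak)) -sumrB; apply: eq_bigr => i _.
  by rewrite (adjointableZ ak) (adjointable_ract ak) ractBl scalerBr.
rewrite (le_trans (nrm_sum _ _))//.
have -> : e / 2 * nrm y = (C + 1) * (e / (2 * (C + 1))) * nrm y.
  by field; rewrite gt_eqF// ltr_wpDl.
rewrite mulrDl mul1r mulrDl.
rewrite (@le_trans _ _ (C * (e / (2 * (C + 1))) * nrm y))//; last first.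
  by rewrite lerDl mulr_ge0 ?nrm_ge0// ltW.
rewrite /C -mulrA mulr_suml ler_sum// => i _; rewrite nrmZ -mulrA ler_wpM2l//.
rewrite (le_trans (nrm_ract _ _))//.
have zi : (zy i).1 \in [seq (zy i).1 | i <- enum 'I_n].
  by apply/mapP; exists i; rewrite ?mem_enum.
rewrite (le_trans (ler_pM _ _ (kz _ zi) (nrm_inner_le _ _))) ?nrm_ge0//.
by rewrite le_eqVlt; apply/orP; left; apply/eqP; ring.
Qed.

End Compacts.

(** * Rank one operators between A and a Hilbert module *)

Section RankOne.
Context (R : realType) (A : cstarType R).
Implicit Types E : hilbertModType A.

Lemma cstar_ideal_setT : cstar_ideal [set: A].
Proof. by split=> //; apply: closedT. Qed.

Lemma ract_factor E (x : E) : exists z j, x = ract z j.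
Proof.
have [//|z [j [_ xE]]] := cohen_factorization cstar_ideal_setT (x := x).
by exists z, j.
Qed.

(** If x = z j then x b = z <j^*, b>, with the inner product of A. *)
Lemma compacts_ract E (x : E) : compacts (ract x : self_module A -> E).
Proof.
have [z [j ->]] := ract_factor x.
have -> : ract (ract z j) = theta z (cstar j : self_module A).
  apply/funext => b; rewrite -ractA /theta.
  by rewrite -[inner _ _]/(cmul (cstar (cstar j)) b) cstarK.
exact: compacts_in_theta.
Qed.

Lemma compacts_inner E (y : E) : compacts (inner y : E -> self_module A).
Proof.
have [z [j ->]] := ract_factor y.
have -> : inner (ract z j) = theta (cstar j : self_module A) z.
  by apply/funext => w; rewrite inner_ractl.
exact: compacts_in_theta.
Qed.

Lemma mod_idealP E (I : set A) (x : E) : cstar_ideal I ->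
  (forall y, I (inner y x)) -> mod_ideal I x.
Proof.
move=> /cohen_factorization/[apply] -[z [j [Ij ->]]].
by exists z => //; exists j.
Qed.

End RankOne.

(** * The corner of an ideal and the two inclusions *)

(** These properties are shared by K_X and T_X, so that one argument serves the ideals of both. *)
Definition has_compact_edges (R : realType) (A : cstarType R)
    (X : cstarCorrType A) (P : tensorPowers X) (T : op_family P) : Prop :=
  [/\ forall n m, T n m `<=` adjointable (Z := tpow P n),
      forall n, compacts (Z := tpow P n) `<=` T n 0%N &
      forall m, compacts (Y := tpow P m) (Z := tpow P 0) `<=` T 0%N m].

Section Corner.
Context (R : realType) (A : cstarType R) (X : cstarCorrType A).
Context (P : tensorPowers X) (T J : op_family P).
Arguments T n m _ : clear implicits.
Arguments J n m _ : clear implicits.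
Hypothesis T_edges : has_compact_edges T.
Hypothesis J_ideal : is_ideal_of T J.

Let T_adjointable n m : T n m `<=` adjointable (Z := tpow P n).
Proof. by case: T_edges => + _ _; apply. Qed.

Let T_n0 n : compacts (Z := tpow P n) `<=` T n 0%N.
Proof. by case: T_edges. Qed.

Let T_0m m : compacts (Y := tpow P m) (Z := tpow P 0) `<=` T 0%N m.
Proof. by case: T_edges. Qed.

Let J_adjointable n m : J n m `<=` adjointable (Z := tpow P n).
Proof. by case: J_ideal => JT _ _ _; apply: subset_trans (JT n m) _. Qed.

Let J_comp n m l a b : T n m a -> J m l b -> J n l (a \o b).
Proof. by case: J_ideal => _ _ + _; apply. Qed.

Let J_compr n m l a b : J n m a -> T m l b -> J n l (a \o b).
Proof. by case: J_ideal => _ _ _; apply. Qed.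

Let cmul_ract (a : A) : cmul a = ract (a : self_module A).
Proof. by []. Qed.

Let T_cmul (a : A) : T 0%N 0%N (cmul a).
Proof.
by apply: T_n0; rewrite cmul_ract; apply: (@compacts_ract R A (self_module A)).
Qed.

Let cmul_comp (a b : A) : cmul (cmul a b) = cmul a \o cmul b.
Proof. by apply/funext => c /=; rewrite cmulA. Qed.

Lemma cstar_ideal_corner : cstar_ideal (corner00 J).
Proof.
have [_ /(_ 0%N 0%N)[[J0 JZD] cJ] _ _] := J_ideal.
split.
- split.
    rewrite /corner00 /=; suff -> : cmul (0 : A) = 0 by [].
    by apply/funext => b; rewrite cmul0l.
  move=> k a b Ja Jb; rewrite /corner00 /=.
  suff -> : cmul (k *: a + b) = k *: cmul a + cmul b by apply: JZD.
  by apply/funext => c; rewrite cmulDl cmulZl.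
- move=> a /closure_nrm aJ; apply: cJ.
  apply/opclosureP; first exact: J_adjointable.
  split=> [|e e0]; first exact/T_adjointable/T_cmul.
  have [b Jb ab] := aJ e e0; exists (cmul b) => // c.
  by rewrite -cmulBl (le_trans (nrmM _ _))// ler_wpM2r ?nrm_ge0// ltW.
- move=> a b Jb; rewrite /corner00 /= cmul_comp.
  by apply: J_comp Jb; apply: T_cmul.
- move=> a b Ja; rewrite /corner00 /= cmul_comp.
  by apply: J_compr Ja _; apply: T_cmul.
Qed.

(** Left multiplication by <z, a y> is the composite of b |-> y b, a and <z, ->, whose outer factors
    lie in T. *)
Lemma corner_inner n m (a : tpow P m -> tpow P n) y z :
  J n m a -> corner00 J (inner z (a y)).
Proof.
move=> Ja; rewrite /corner00 /=.
have -> : cmul (inner z (a y)) = inner z \o (a \o ract y).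
  apply/funext => b /=; rewrite adjointable_ract ?inner_ract//.
  exact: J_adjointable Ja.
apply: (@J_comp 0%N n 0%N); first exact/T_0m/compacts_inner.
by apply: (@J_compr n m 0%N) => //; apply/T_n0/compacts_ract.
Qed.

Lemma corner_mod_ideal n m (a : tpow P m -> tpow P n) :
  J n m a -> adjointable_in (corner00 J) a.
Proof.
move=> Ja; split=> [|_ [y _ <-]]; first exact: J_adjointable Ja.
by apply: mod_idealP => [|z]; [exact: cstar_ideal_corner|apply: corner_inner].
Qed.

(** The generator [theta (ract z j) y] factors through A as <y, ->, then left multiplication by j,
    then b |-> z b. *)
Lemma KXJ_corner_sub : subfamily (KXJ P (corner00 J)) J.
Proof.
have [_ sJ _ _] := J_ideal.
move=> n m; have [subJ cJ] := sJ n m.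
apply: compacts_in_min => // _ y [z _ [j Jj <-]].
have -> : theta (ract z j) y = ract z \o (cmul j \o inner y).
  by apply/funext => w; rewrite /theta /= ractA.
apply: (@J_comp n 0%N m); first exact/T_n0/compacts_ract.
by apply: (@J_compr 0%N 0%N m) => //; apply/T_0m/compacts_inner.
Qed.

End Corner.

(** * The correspondence between ideals of A and ideals of K_X *)

Section CompactFamilies.
Context (R : realType) (A : cstarType R) (X : cstarCorrType A).
Context (P : tensorPowers X).

Lemma KX_compact_edges : has_compact_edges (KX P).
Proof.
by split=> [n m|n|m]; [exact: (@compacts_in_adjointable _ _ _ _ setT)| |].
Qed.

Lemma TX_compact_edges : has_compact_edges (TX P).
Proof.
split=> [n m|n|m]; rewrite /TX ?orbT//.
by case: ifP => _; [exact: (@compacts_in_adjointable _ _ _ _ setT)|move=> ?].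
Qed.

Lemma KXJ_ideal (I : set A) : cstar_ideal I -> is_ideal_of (KX P) (KXJ P I).
Proof.
move=> I_ideal; split.
- by move=> n m; apply: compacts_in_sub.
- by move=> n m; split; [exact: subspace_compacts_in|exact: opclosed_compacts_in].
- move=> n m l a b Ka; have aa := compacts_in_adjointable Ka.
  apply: compacts_in_comp => //; first exact: compacts_in_bounded Ka.
  move=> _ [z _ [j Ij <-]]; rewrite adjointable_ract//.
  by exists (a z) => //; exists j.
- move=> n m l a b Ka Kb.
  apply: compacts_in_compr Ka; first exact: compacts_in_adjointable Kb.
  exact: compacts_in_bounded Kb.
Qed.

Lemma corner_KXJ (I : set A) : cstar_ideal I -> corner00 (KXJ P I) = I.
Proof.
move=> I_ideal; apply/seteqP; split=> a.
  move=> /compacts_inP[_ aI]; apply: (ideal_closed I_ideal) => e e0.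
  have e2 : 0 < e / 2 by rewrite divr_gt0.
  have [T' T'I aT'] := aI _ e2.
  (* On A, the operator [theta (cmul z j) y] is left multiplication by z j y^*, an element of I. *)
  have [c Ic T'E] : exists2 c, I c & T' = cmul c.
    move: T' T'I {aT'}; apply: finite_rank_min.
      split; first by exists 0; [exact: ideal0|apply/funext => b; rewrite cmul0l].
      move=> k _ _ [c Ic ->] [d Id ->]; exists (k *: c + d).
        exact: idealZD.
      by apply/funext => b; rewrite cmulDl cmulZl.
    move=> _ y [z _ [j Ij <-]]; exists (cmul (cmul z j) (cstar y)).
      by apply: idealMr => //; apply: idealMl.
    by apply/funext => b; rewrite -cmulA.
  (* Evaluation at the adjoint of a - c turns the operator bound into |a - c|^2 <= (e / 2) |a -
     c|. *)
  exists c => //; have := aT' (cstar (a - c)).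
  rewrite T'E -[X in nrm X]cmulBl nrm_Mstar nrm_star.
  have := nrm_ge0 (a - c); nra.
move=> Ia; have fac (b : A) : I b -> exists z j, I j /\ b = cmul z j.
  move=> Ib; have [y|z [j [Ij bE]]] :=
      @cohen_factorization R A I I_ideal (self_module A) b.
    by apply: (idealMl I_ideal).
  by exists z, j.
(* Factoring twice, a = z i and i^* = w j, gives a = z j^* w^*, so multiplication by a has rank one
   with its range vector z j^* in A I. *)
have [z [i [Ii ->]]] := fac a Ia.
have [w [j [Ij iE]]] := fac (cstar i) (ideal_star I_ideal Ii).
rewrite /corner00 /= -(cstarK i) iE cstarM.
have -> : cmul (cmul z (cmul (cstar j) (cstar w))) =
    theta (ract (z : self_module A) (cstar j)) (w : self_module A).
  by apply/funext => b; rewrite cmulA -cmulA.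
apply: compacts_in_theta; exists z => //; exists (cstar j) => //.
exact: ideal_star.
Qed.

Lemma ideal_KX_sub (J : op_family P) : is_ideal_of (KX P) J ->
  subfamily J (KXJ P (corner00 J)).
Proof.
move=> J_ideal n m a Ja; have [JK _ _ _] := J_ideal.
have I_ideal := cstar_ideal_corner KX_compact_edges J_ideal.
have Ka := JK _ _ _ Ja; have aa := compacts_in_adjointable Ka; have [b ab] := aa.
apply/compacts_inP; split=> // e e0.
have [k kF ak] := compacts_approx Ka e0; exists (k \o a) => //.
move: k kF {ak}; apply: (@finite_rank_min _ _ _ _ _
    (fun k => finite_rank (mod_ideal (corner00 J)) (k \o a))).
  have [F0 FZD] := subspace_finite_rank (tpow P m)
    (mod_ideal (corner00 J) : set (tpow P n)).
  by split=> // c k k'; apply: FZD.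
move=> u v _; rewrite (theta_comp _ _ ab).
(* Since <y, b v> = <a y, v> is the adjoint of <v, a y>, it lies in the corner, and Cohen's
   factorization applies to b v. *)
have [z _ [i Ii <-]] : mod_ideal (corner00 J) (b v).
  apply: mod_idealP => // y; rewrite -ab -inner_star.
  apply: (ideal_star I_ideal); exact: (corner_inner KX_compact_edges J_ideal).
(* The ideal element moves across [theta] as its adjoint, from the second vector to the first. *)
have -> : theta u (ract z i) = theta (ract u (cstar i)) z.
  by apply/funext => w; rewrite /theta inner_ractl ractA.
apply: finite_rank_theta; exists u => //; exists (cstar i) => //.
exact: ideal_star.
Qed.

End CompactFamilies.

Theorem proposition2p17 (R : realType) (A : cstarType R)
    (X : cstarCorrType A) (P : tensorPowers X) :
  (forall J : op_family P, is_ideal_of (TX P) J ->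
     [/\ cstar_ideal (corner00 J),
         subfamily (KXJ P (corner00 J)) J &
         subfamily J (TXJ P (corner00 J))])
  /\
  [/\ forall I : set A, cstar_ideal I ->
        is_ideal_of (KX P) (KXJ P I) /\ corner00 (KXJ P I) = I &
      forall J : op_family P, is_ideal_of (KX P) J ->
        cstar_ideal (corner00 J) /\
        (forall n m : nat, KXJ P (corner00 J) n m = J n m)].
Proof.
split=> [J J_ideal|].
  split; first exact: cstar_ideal_corner (TX_compact_edges P) J_ideal.
    exact: KXJ_corner_sub (TX_compact_edges P) J_ideal.
  move=> n m a Ja; split.
    exact: corner_mod_ideal (TX_compact_edges P) J_ideal n m a Ja.
  by have [JT _ _ _] := J_ideal; apply: JT.
split=> [I I_ideal|J J_ideal].
  by split; [exact: KXJ_ideal|exact: corner_KXJ].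
split=> [|n m]; first exact: cstar_ideal_corner (KX_compact_edges P) J_ideal.
apply/seteqP; split; last exact: ideal_KX_sub.
exact: KXJ_corner_sub (KX_compact_edges P) J_ideal n m.
Qed.
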